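(* Consider the $\ell_p$-norm RSA iteration described in the context, with $p\ge1$ and $\lambda>0$. Suppose that: (1) for every worker $i$ the local cost $\tilde x\mapsto\mathbb{E}[F(\tilde x,\xi_i)]$ is strongly convex with constant $\mu_i>0$, and $f_0$ is strongly convex with constant $\mu_0>0$; (2) for every worker $i$ the local cost $\tilde x\mapsto\mathbb{E}[F(\tilde x,\xi_i)]$ has Lipschitz continuous gradient with constant $L_i$, and $f_0$ has Lipschitz continuous gradient with constant $L_0$; (3) for every worker $i$ the data sampling is i.i.d. across time with $\xi_i^k\sim\mathcal{D}_i$, and the variance of $\nabla F(\tilde x,\xi_i)$ is bounded by $\delta_i^2$, namely $\mathbb{E}\big[\|\nabla\mathbb{E}[F(\tilde x,\xi_i)]-\nabla F(\tilde x,\xi_i)\|^2\big]\le\delta_i^2$. Let $\epsilon\in\big(0,\frac{2\mu_0L_0}{\mu_0+L_0}\big)$ be any constant, and set $$\eta=\min\Big\{\min_{i\in\mathcal{R}}\frac{2\mu_iL_i}{\mu_i+L_i},\ \frac{2\mu_0L_0}{\mu_0+L_0}-\epsilon\Big\},\qquad \underline{\alpha}=\min\Big\{\min_{i\in\mathcal{R}}\frac{1}{2(\mu_i+L_i)},\ \frac{1}{2(\mu_0+L_0)}\Big\},\qquad \overline{\alpha}>\frac1\eta ,$$ and take step sizes $\alpha^{k+1}=\min\{\underline{\alpha},\frac{\overline{\alpha}}{k+1}\}$ for $k\ge0$. Then there exists a smallest (nonnegative) integer $k_0$ satisfying $\underline{\alpha}\ge\frac{\overline{\alpha}}{k_0+1}$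 such that $$\mathbb{E}\|x^{k+1}-x^*\|^2\le(1-\eta\underline{\alpha})^k\,\mathbb{E}\|x^0-x^*\|^2+\frac1\eta\big(\underline{\alpha}\Delta_0+\Delta_2\big)\quad\text{for all } k<k_0,$$ and $$\mathbb{E}\|x^{k+1}-x^*\|^2\le\frac{\Delta_1}{k+1}+\overline{\alpha}\Delta_2\quad\text{for all } k\ge k_0,$$ where $$\Delta_1=\max\Big\{\frac{\overline{\alpha}^2\Delta_0}{\eta\overline{\alpha}-1},\ (k_0+1)\,\mathbb{E}\|x^{k_0}-x^*\|^2+\frac{\overline{\alpha}^2\Delta_0}{k_0+1}\Big\},$$ $$\Delta_0=16\lambda^2rd+16\lambda^2r^2d+2\lambda^2q^2d+2\sum_{i\in\mathcal{R}}\delta_i^2,\qquad \Delta_2=\frac{\lambda^2q^2d}{\epsilon}.$$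
   Context: Setting. There are a master and $m$ workers, partitioned into a set $\mathcal{R}$ of regular workers, $|\mathcal{R}|=r=m-q$, and a set $\mathcal{B}$ of Byzantine workers, $|\mathcal{B}|=q$. For each worker $i$, $\xi_i$ is a random variable with distribution $\mathcal{D}_i$ (the distributions may differ across workers) and $F(\tilde x,\xi_i)$ is its loss function, $\tilde x\in\mathbb{R}^d$, with $\nabla$ denoting the gradient in $\tilde x$. $f_0:\mathbb{R}^d\to\mathbb{R}$ is a regularization term. $\|\cdot\|$ is the Euclidean norm, $\|\cdot\|_p$ the $\ell_p$ norm on $\mathbb{R}^d$. Regularized problem. $x=[x_i;x_0]\in\mathbb{R}^{(r+1)d}$ stacks $x_i\in\mathbb{R}^d$ ($i\in\mathcal{R}$) and $x_0\in\mathbb{R}^d$, and $$x^*=\arg\min_{x=[x_i;x_0]}\ \sum_{i\in\mathcal{R}}\Big(\mathbb{E}[F(x_i,\xi_i)]+\lambda\|x_i-x_0\|_p\Big)+f_0(x_0).$$ $\ell_p$-norm RSA iteration. Starting from initial iterates $x_i^0$ ($i\in\mathcal{R}$) and $x_0^0$, for $k\ge0$: $$x_i^{k+1}=x_i^k-\alpha^{k+1}\big(\nabla F(x_i^k,\xi_i^k)+\lambda s_i^k\big),\quad i\in\mathcal{R},$$ $$x_0^{k+1}=x_0^k-\alpha^{k+1}\Big(\nabla f_0(x_0^k)+\lambda\Big(\sum_{i\in\mathcal{R}}w_i^k+\sum_{j\in\mathcal{B}}t_j^k\Big)\Big),$$ where $s_i^k$ is a subgradient of $u\mapsto\|u-x_0^k\|_p$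 at $u=x_i^k$, $w_i^k$ is a subgradient of $u\mapsto\|u-x_i^k\|_p$ at $u=x_0^k$, and $t_j^k$ is a subgradient of $u\mapsto\|u-z_j^k\|_p$ at $u=x_0^k$. Here $\xi_i^k$ is the sample drawn by regular worker $i$ at time $k$, and $z_j^k\in\mathbb{R}^d$ is an arbitrary vector sent to the master by the Byzantine worker $j\in\mathcal{B}$. $x^k=[x_i^k;x_0^k]\in\mathbb{R}^{(r+1)d}$ denotes the stacked iterates.
   Formalization: The subgradients are required to satisfy w_i^k = −s_i^k (otherwise at ties x_i^k = x_0^k the iterates can stay away from x* and the claim fails); samples ξ_i^k are taken independent of the information forming x^0,…,x^k, so Byzantine messages do not anticipate future samples. *)

(* Defs.v *)
From HB Require Import structures.
From mathcomp Require Import all_boot all_order all_algebra.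
From mathcomp Require Import all_classical all_reals all_analysis.
Set Implicit Arguments.
Unset Strict Implicit.
Unset Printing Implicit Defensive.
Import Order.TTheory GRing.Theory Num.Theory.
Import numFieldNormedType.Exports.
Local Open Scope classical_set_scope.
Local Open Scope ring_scope.

Definition dotp (R : realType) (d : nat) (u v : 'rV[R]_d) : R :=
  \sum_(j < d) u 0 j * v 0 j.

(* The library norm `|v| on 'rV[R]_d is the sup norm, hence this one. *)
Definition enorm (R : realType) (d : nat) (v : 'rV[R]_d) : R :=
  Num.sqrt (dotp v v).

(* Meaningful for 1 <= p; the value at -oo is a dummy. *)
Definition lpnorm (R : realType) (d : nat) (p : \bar R) (v : 'rV[R]_d) : R :=
  match p with
  | p'%:E => (\sum_(j < d) `|v 0 j| `^ p') `^ p'^-1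
  | +oo%E => \big[Num.max/0]_(j < d) `|v 0 j|
  | -oo%E => 0
  end.

Definition gradient (R : realType) (d : nat) (f : 'rV[R]_d -> R)
    (x : 'rV[R]_d) : 'rV[R]_d :=
  \row_(j < d) 'D_(delta_mx 0 j) f x.

Definition is_subgradient (R : realType) (d : nat) (g : 'rV[R]_d -> R)
    (u s : 'rV[R]_d) : Prop :=
  forall v : 'rV[R]_d, g u + dotp s (v - u) <= g v.

Definition strongly_convex (R : realType) (d : nat) (mu : R)
    (f : 'rV[R]_d -> R) : Prop :=
  forall (x y : 'rV[R]_d) (t : R), 0 <= t -> t <= 1 ->
    f (t *: x + (1 - t) *: y) <=
      t * f x + (1 - t) * f y - mu / 2 * t * (1 - t) * enorm (x - y) ^+ 2.

Definition lipschitz_gradient (R : realType) (d : nat) (L : R)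
    (f : 'rV[R]_d -> R) : Prop :=
  (forall x : 'rV[R]_d, differentiable f x) /\
  (forall x y : 'rV[R]_d,
     enorm (gradient f x - gradient f y) <= L * enorm (x - y)).

Definition local_cost (R : realType) (d : nat) (dX : measure_display)
    (Xi : measurableType dX) (F : 'rV[R]_d -> Xi -> R) (D : probability Xi R)
    (x : 'rV[R]_d) : R :=
  fine 'E_D[F x]%E.

Definition bounded_variance (R : realType) (d : nat) (dX : measure_display)
    (Xi : measurableType dX) (F : 'rV[R]_d -> Xi -> R) (D : probability Xi R)
    (delta : R) : Prop :=
  forall x : 'rV[R]_d,
    ('E_D[fun s => (enorm (gradient (local_cost F D) x
                           - gradient (F^~ s) x) ^+ 2)%R] <= (delta ^+ 2)%:E)%E.

Definition iid_sampling (R : realType) (dO dX : measure_display)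
    (Omega : measurableType dO) (P : probability Omega R)
    (Xi : measurableType dX) (D : probability Xi R)
    (xi : nat -> Omega -> Xi) : Prop :=
  [/\ forall k, measurable_fun setT (xi k),
      forall k (A : set Xi), measurable A -> P (xi k @^-1` A) = D A &
      forall (K : seq nat) (A : nat -> set Xi), uniq K ->
        (forall k, measurable (A k)) ->
        P (\bigcap_(k in [set` K]) (xi k @^-1` A k)) =
        (\prod_(k <- K) P (xi k @^-1` A k))%E].

Definition is_filtration (dO : measure_display) (Omega : measurableType dO)
    (Fil : nat -> set (set Omega)) : Prop :=
  [/\ forall k, sigma_algebra setT (Fil k),
      forall k, Fil k `<=` measurable &
      forall k, Fil k `<=` Fil k.+1].

Definition mfun_wrt (dO dX : measure_display) (Omega : measurableType dO)
    (Xi : measurableType dX) (G : set (set Omega)) (X : Omega -> Xi) : Prop :=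
  forall A : set Xi, measurable A -> G (X @^-1` A).

Definition vec_mfun_wrt (R : realType) (d : nat) (dO : measure_display)
    (Omega : measurableType dO) (G : set (set Omega))
    (X : Omega -> 'rV[R]_d) : Prop :=
  forall j : 'I_d, mfun_wrt G (fun w => X w 0 j).

Definition indep_of (R : realType) (dO dX : measure_display)
    (Omega : measurableType dO) (P : probability Omega R)
    (Xi : measurableType dX) (G : set (set Omega)) (X : Omega -> Xi) : Prop :=
  forall (B : set Omega) (A : set Xi), G B -> measurable A ->
    P (B `&` X @^-1` A) = (P B * P (X @^-1` A))%E.

(* A point [x_i; x_0] of R^((r+1)d): only the blocks x.1 i with i regular
   are ever used. *)
Definition stacked (R : realType) (m d : nat) : Type :=
  (('I_m -> 'rV[R]_d) * 'rV[R]_d)%type.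

Definition sqdist (R : realType) (m d : nat) (Reg : {set 'I_m})
    (x y : stacked R m d) : R :=
  \sum_(i in Reg) enorm (x.1 i - y.1 i) ^+ 2 + enorm (x.2 - y.2) ^+ 2.

Definition regularized_cost (R : realType) (m d : nat) (Reg : {set 'I_m})
    (lam : R) (p : \bar R) (f : 'I_m -> 'rV[R]_d -> R) (f0 : 'rV[R]_d -> R)
    (x : stacked R m d) : R :=
  \sum_(i in Reg) (f i (x.1 i) + lam * lpnorm p (x.1 i - x.2)) + f0 x.2.

Definition is_minimizer (T : Type) (R : realType) (g : T -> R) (x : T) : Prop :=
  forall y : T, g x <= g y.

(* The iteration along one sample path: xi i k is the sample of worker i, and
   z j k the message of worker j, at time k.
   The clause w i k = - s i k expresses that [s i k; w i k] is a subgradient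
   of the single penalty term (u, v) |-> ||u - v||_p at (x_i^k, x_0^k), so
   that the direction followed is a subgradient of the regularized cost.  It
   is not implied by the clauses on s and w at points where ||.||_p is not
   differentiable: for x_i^k = x_0^k both could be the same nonzero vector,
   and the iterates could then stay away from the minimizer. *)
Definition rsa_path (R : realType) (m d : nat) (dX : measure_display)
    (Xi : measurableType dX) (Reg Byz : {set 'I_m}) (lam : R) (p : \bar R)
    (F : 'rV[R]_d -> Xi -> R) (f0 : 'rV[R]_d -> R) (alpha : nat -> R)
    (xi : 'I_m -> nat -> Xi) (z s w t : 'I_m -> nat -> 'rV[R]_d)
    (x : nat -> stacked R m d) : Prop :=
  [/\ forall k i, i \in Reg ->
        [/\ is_subgradient (fun u => lpnorm p (u - (x k).2)) ((x k).1 i) (s i k),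
            is_subgradient (fun u => lpnorm p (u - (x k).1 i)) (x k).2 (w i k) &
            w i k = - s i k],
      forall k j, j \in Byz ->
        is_subgradient (fun u => lpnorm p (u - z j k)) (x k).2 (t j k),
      forall k i, i \in Reg ->
        (x k.+1).1 i = (x k).1 i
          - alpha k.+1 *: (gradient (F^~ (xi i k)) ((x k).1 i) + lam *: s i k) &
      forall k,
        (x k.+1).2 = (x k).2
          - alpha k.+1 *: (gradient f0 (x k).2
             + lam *: (\sum_(i in Reg) w i k + \sum_(j in Byz) t j k))].

(* No look-ahead: Fil k is the information available before the samples of
   time k are drawn.  The Byzantine messages and the choices of subgradients
   may depend on anything, as long as x k stays Fil k-measurable. *)
Definition nonanticipating (R : realType) (m d : nat) (dO dX : measure_display)
    (Omega : measurableType dO) (P : probability Omega R)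
    (Xi : measurableType dX) (Reg : {set 'I_m}) (Fil : nat -> set (set Omega))
    (xi : 'I_m -> nat -> Omega -> Xi) (x : nat -> Omega -> stacked R m d)
    : Prop :=
  [/\ is_filtration Fil,
      forall k i, i \in Reg -> vec_mfun_wrt (Fil k) (fun o => (x k o).1 i),
      forall k, vec_mfun_wrt (Fil k) (fun o => (x k o).2),
      forall k i, i \in Reg -> mfun_wrt (Fil k.+1) (xi i k) &
      forall k i, i \in Reg -> indep_of P (Fil k) (xi i k)].

(* Main.v *)
(** Write x* for the minimizer, a_i for x_i^k - x*_i and a_0 for x_0^k - x*_0.
    First-order optimality provides subgradients s*_i of the penalty terms at x*
    with grad E[F_i] + lam s*_i = 0 at x*_i and grad f_0 = lam sum_i s*_i at x*_0.
    Subtracting these equations from the iteration, the smooth parts contract by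
    Nesterov's inequality for strongly convex functions with Lipschitz gradient,
    the penalty terms contribute a nonnegative inner product by monotonicity of
    the subdifferential, and the Byzantine terms are absorbed by AM-GM, since the
    entries of a subgradient of ||.||_p are bounded by 1.  The gradient noise is
    orthogonal in expectation to a_i, whence a scalar recursion
    E_(k+1) <= (1 - eta alpha) E_k + alpha^2 Delta0 + alpha Delta2,
    which is solved in the two step size regimes.

    The identity E[grad F(x, xi)] = grad E[F(x, xi)] is not assumed; it follows,
    at every point x, from the bounded variance.  Indeed an everywhere
    differentiable function satisfies |f(b) - f(a)| <= int_a^b |f'|, so the
    difference quotients of F - E F are bounded in L^2 by the variance, hence
    uniformly integrable, and their vanishing expectations converge to the
    expectation of the derivative. *)

Require Import Defs.
From HB Require Import structures.
From mathcomp Require Import all_boot all_order all_algebra.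
From mathcomp Require Import all_classical all_reals all_analysis measurable_realfun.
From mathcomp Require Import ring lra.
Set Implicit Arguments.
Unset Strict Implicit.
Unset Printing Implicit Defensive.
Import Order.TTheory GRing.Theory Num.Theory.
Import numFieldNormedType.Exports.
Local Open Scope classical_set_scope.
Local Open Scope ring_scope.

(** * Increments of everywhere differentiable functions *)

(** The strict slack in [|l| < K] absorbs the error of the difference quotient. This is the only
    form in which differentiability enters the continuous induction below. *)
Lemma near_lipschitz_derive (R : realType) (f : R -> R) (c l K : R) :
  is_derive c 1 f l -> `|l| < K ->
  \forall s \near c, `|f s - f c| <= K * `|s - c|.
Proof.
move=> [df dl] lK.
have : h^-1 *: ((f \o shift c) (h *: 1) - f c) @[h --> 0^'] --> l.
  by rewrite -dl; exact: df.
move=> /cvgrPdist_lt /(_ (K - `|l|)).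
rewrite subr_gt0 => /(_ lK).
move=> /nbhs_ballP[e /= e0 H].
apply/nbhs_ballP; exists e => //= s.
rewrite /ball/= distrC => se.
have [->|sc] := eqVneq s c; first by rewrite !subrr normr0 mulr0.
have := H (s - c).
rewrite /ball/= sub0r normrN => /(_ se).
rewrite subr_eq0 => /(_ sc).
rewrite /GRing.scale/= mulr1 subrK distrC => {}H.
have : `|(s - c)^-1 * (f s - f c)| <= K.
  rewrite -[X in `|X|](subrK l) (le_trans (ler_normD _ _))//.
  by rewrite -lerBrDr ltW.
by rewrite normrM normfV mulrC ler_pdivrMr ?normr_gt0 ?subr_eq0.
Qed.

Section le_integral_derive.
Local Open Scope ereal_scope.
Context (R : realType).
Local Notation mu := (@lebesgue_measure R).

(* Continuous induction: the set of s such that |f s - f a| is bounded by the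
   weighted measure of the U n within [a, s] contains its supremum, and the
   derivative bound on U n prolongs it to the right of any point before b. *)
Lemma abs_increment_le_cover (f df : R -> R) (a b : R) (c : nat -> R)
    (U : nat -> set R) : (a <= b)%R ->
  (forall s, is_derive s (1 : R)%R f (df s)) ->
  (forall n, (0 <= c n)%R) -> (forall n, open (U n)) ->
  (forall s, (a <= s <= b)%R -> exists2 n, U n s & (`|df s| < c n)%R) ->
  `|f b - f a|%:E <= \sum_(n <oo) (c n)%:E * mu (U n).
Proof.
move=> ab fdf c0 oU cover.
pose A s := \sum_(n <oo) (c n)%:E * mu (U n `&` `[a, s]).
have mU n : measurable (U n) by exact: open_measurable.
have A0 s n : 0 <= (c n)%:E * mu (U n `&` `[a, s]).
  by rewrite mule_ge0 ?lee_fin.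
have A_mono s t : (s <= t)%R -> A s <= A t.
  move=> st; apply: lee_nneseries => // n _.
  rewrite lee_wpmul2l ?lee_fin// le_measure ?inE//;
    try (apply: measurableI; [exact: mU|exact: measurable_itv]).
  apply: classical_sets.setIS => x /=; rewrite !in_itv/= => /andP[-> xs].
  exact: le_trans xs st.
have A_step s t n : (a <= s)%R -> (s <= t)%R -> `]s, t] `<=` U n ->
    A s + (c n * (t - s))%:E <= A t.
  move=> as_ st Un.
  have AE : A t = A s + \sum_(k <oo) (c k)%:E * mu (U k `&` `]s, t]).
    rewrite -nneseriesD//; last first.
      by move=> k _ _; rewrite mule_ge0 ?lee_fin.
    apply: eq_eseriesr => k _.
    rewrite -ge0_muleDr//; congr (_ * _).
    rewrite -measureU//=; try (apply: measurableI; [exact: mU|exact: measurable_itv]).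
      rewrite -setIUr; congr (mu (_ `&` _)).
      by rewrite -itv_bndbnd_setU// bnd_simp.
    rewrite -subset0 => x [[_ +] [_ /=]]; rewrite /= !in_itv/= => /andP[_ xs].
    by rewrite ltNge xs.
  rewrite AE leeD2l//.
  rewrite (@nneseriesD1 _ _ n)//; last by move=> k _; rewrite mule_ge0 ?lee_fin.
  have -> : U n `&` `]s, t] = [set` `]s, t]] :> set R.
    by apply/seteqP; split=> [x []//|x xst]; split=> //; exact: Un.
  rewrite lebesgue_measure_itv/= lte_fin.
  have -> : (if (s < t)%R then t%:E + (- s)%:E else 0%R) = (t - s)%:E.
    case: ltP => // ts; have -> : t = s by apply/le_anti; rewrite ts st.
    by rewrite subrr.
  rewrite -EFinM.
  by rewrite leeDl// nneseries_ge0// => k _ _; rewrite mule_ge0 ?lee_fin.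
pose S := [set s | (a <= s <= b)%R /\ `|f s - f a|%:E <= A s].
have Sa : S a.
  split; first by rewrite lexx.
  by rewrite subrr normr0 nneseries_ge0.
have hS : has_sup S by split; [exists a|exists b => s [/andP[]]].
have ac : (a <= sup S)%R by apply: sup_upper_bound.
have cb : (sup S <= b)%R by apply: sup_le_ub; [exists a|move=> s [/andP[]]].
(* The supremum is attained: points of [S] close to [sup S] have nearly the same value of [f] by the
   slope bound there, and [A] is monotone. *)
have Sc : S (sup S).
  split; first by rewrite ac cb.
  apply/lee_addgt0Pr => e e0.
  have /(near_lipschitz_derive (fdf (sup S))) : (`|df (sup S)| < `|df (sup S)| + 1)%R by rewrite ltrDl.
  move=> /nbhs_ballP[d /= d0 H].
  have M0 : (0 < Num.min d (e / (`|df (sup S)| + 1)))%R.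
    by rewrite lt_min d0 divr_gt0// ltr_wpDl.
  have [s Ss sc] := sup_adherent M0 hS.
  have ss : (s <= sup S)%R by apply: sup_upper_bound.
  have sd : (`|sup S - s| < Num.min d (e / (`|df (sup S)| + 1)))%R.
    by rewrite ger0_norm ?subr_ge0//; lra.
  move: sd; rewrite lt_min => /andP[/H] {}H.
  rewrite ltr_pdivlMr ?ltr_wpDl// => He.
  have -> : (f (sup S) - f a = (f s - f a) - (f s - f (sup S)))%R by lra.
  apply: (@le_trans _ _ (`|f s - f a| + e)%:E).
    rewrite lee_fin (le_trans (ler_normB _ _))// lerD2l (le_trans H)//.
    by rewrite distrC mulrC ltW.
  by rewrite EFinD leeD2r// (le_trans Ss.2)// A_mono.
have [cbE|] := eqVneq (sup S) b.
  rewrite -cbE (le_trans Sc.2)//; apply: lee_nneseries => // n _.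
  rewrite lee_wpmul2l ?lee_fin//; apply: le_measure; last by move=> x [].
    by rewrite inE; apply: measurableI; [exact: mU|exact: measurable_itv].
  by rewrite inE; exact: mU.
move=> cneb; have {cneb}cltb : (sup S < b)%R by rewrite lt_neqAle cneb.
have [|n Un dfn] := cover (sup S); first by rewrite ac cb.
have /nbhs_ballP[d1 /= d10 H1] := open_nbhs_nbhs (conj (oU n) Un).
have /nbhs_ballP[d2 /= d20 H2] := near_lipschitz_derive (fdf (sup S)) dfn.
(* Half of the smaller radius keeps []sup S, t]] inside both balls, and the minimum with [b] keeps
   [t] admissible. Such a [t] in [S] contradicts the supremum. *)
pose t := Num.min b (sup S + (Num.min d1 d2) / 2)%R.
have m0 : (0 < Num.min d1 d2)%R by rewrite lt_min d10.
have ct : (sup S < t)%R by rewrite lt_min cltb ltrDl divr_gt0.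
have tm : (t <= sup S + (Num.min d1 d2) / 2)%R by rewrite ge_min lexx orbT.
have [m1 m2] : (Num.min d1 d2 <= d1)%R /\ (Num.min d1 d2 <= d2)%R.
  by rewrite !ge_min !lexx orbT.
have tb : (t <= b)%R by rewrite ge_min lexx.
suff : S t by move=> /(sup_upper_bound hS); rewrite leNgt ct.
split; first by rewrite tb andbT (le_trans ac)// ltW.
have tSn : (`|t - sup S| = t - sup S)%R by rewrite ger0_norm// subr_ge0 ltW.
apply: le_trans (A_step _ _ n ac (ltW ct) _).
  have -> : (f t - f a = (f (sup S) - f a) + (f t - f (sup S)))%R by lra.
  apply: (@le_trans _ _ (`|f (sup S) - f a| + c n * (t - sup S))%:E).
    rewrite lee_fin (le_trans (ler_normD _ _))// lerD2l.
    rewrite -tSn; apply: H2; rewrite /ball/= distrC tSn; lra.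
  by rewrite EFinD leeD2r// Sc.2.
move=> x /=; rewrite in_itv/= => /andP[cx xt].
apply: H1; rewrite /ball/= distrC ger0_norm; lra.
Qed.

(** The layers of [g] of height [e] are enlarged to open sets of little extra measure, to which the
    covering bound applies. The integral on the right may be infinite. *)
Lemma abs_increment_le_integral (f df g : R -> R) (a b : R) : (a <= b)%R ->
  (forall s, is_derive s (1%R : R) f (df s)) ->
  measurable_fun setT g -> (forall s, `|df s| <= g s)%R ->
  `|f b - f a|%:E <= \int[mu]_(s in `[a, b]) (g s)%:E.
Proof.
move=> ab fdf mg dfg.
have g0 s : (0 <= g s)%R by exact: le_trans (dfg s).
apply/lee_addgt0Pr => e0 e00.
(* Rounding [g] up to the top of its layer costs [e * (b - a)], the enlargement of the layers costs
   [e]; together they make [e0]. *)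
pose e := (e0 / (1 + (b - a)))%R.
have ba : (0 <= b - a)%R by rewrite subr_ge0.
have e_gt0 : (0 < e)%R by rewrite divr_gt0// ltr_pwDl.
pose c n := (n.+1%:R * e)%R.
have c_gt0 n : (0 < c n)%R by rewrite mulr_gt0.
pose E n := `[a, b] `&` [set s | (c n - e <= g s < c n)%R].
have mE n : measurable (E n).
  apply: measurableI => //.
  have -> : [set s | (c n - e <= g s < c n)%R] = setT `&` g @^-1` `[(c n - e)%R, c n[.
    by rewrite setTI; apply/seteqP; split => x /=; rewrite in_itv.
  exact: mg.
have muab : mu `[a, b] = (b - a)%:E.
  rewrite lebesgue_measure_itv/= lte_fin.
  case: ltP => // ba'; have -> : b = a by apply/le_anti; rewrite ab ba'.
  by rewrite subrr.
have muE n : mu (E n) < +oo.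
  apply: (@le_lt_trans _ _ (mu `[a, b])); last by rewrite muab ltry.
  by apply: le_measure; [rewrite inE; exact: mE|rewrite inE; exact: measurable_itv|move=> x []].
(* Dividing the excess measure by [c n] makes the weighted excesses sum up geometrically to [e]. *)
have eU n : exists V : set R, [/\ open V, E n `<=` V &
    mu (V `\` E n) < (e / (2 ^ n.+1)%:R / c n)%:E].
  apply: lebesgue_regularity_outer; [exact: mE|exact: muE|].
  by rewrite divr_gt0 ?c_gt0// divr_gt0// ltr0n expn_gt0.
have [U HU] := choice eU.
have oU n : open (U n) by case: (HU n).
apply: (le_trans (abs_increment_le_cover ab fdf (fun n => ltW (c_gt0 n)) oU _)).
  move=> s asb.
  have [n Ens] : exists n, E n s.
    have /truncn_itv := divr_ge0 (g0 s) (ltW e_gt0).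
    set n := Num.truncn _ => /andP[h1 h2]; exists n; split.
      by rewrite /= in_itv.
    rewrite /= /c -[X in (_ - X)%R]mul1r -mulrBl -natr1 addrK.
    by rewrite -ler_pdivlMr// h1/= natr1 -ltr_pdivrMr.
  exists n; first by case: (HU n) => _ + _; exact.
  by case: Ens => _ /= /andP[_]; exact: le_lt_trans.
apply: (@le_trans _ _ (\sum_(n <oo) ((c n)%:E * mu (E n) + (e / (2 ^ n.+1)%:R)%:E))).
  apply: lee_nneseries => [n _ _|n _]; first by rewrite mule_ge0// lee_fin ltW.
  case: (HU n) => oUn EU UE.
  have mU : measurable (U n) by exact: open_measurable.
  have -> : mu (U n) = mu (E n) + mu (U n `\` E n).
    rewrite -measureU; first by rewrite setDUK.
    - exact: mE.
    - by apply: measurableD; [exact: mU|exact: mE].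
    - by rewrite setDIK.
  rewrite ge0_muleDr// leeD2l//.
  apply: (@le_trans _ _ ((c n)%:E * (e / (2 ^ n.+1)%:R / c n)%:E)).
    by rewrite lee_wpmul2l ?lee_fin ?ltW.
  by rewrite -EFinM lee_fin mulrC divfK// gt_eqF.
apply: (le_trans (epsilon_trick _ _ (ltW e_gt0))).
  by move=> n; rewrite mule_ge0// lee_fin ltW.
have -> : e0 = (e * (b - a) + e)%R.
  rewrite /e -[X in (_ + X)%R]mulr1 -mulrDr [(b - a + 1)%R]addrC divfK//.
  by rewrite gt_eqF// ltr_pwDl.
rewrite EFinD addeA leeD2r//.
have mge : measurable_fun `[a, b] (fun s => (g s + e)%:E).
  apply/measurable_EFinP; apply: measurable_funD => //.
  exact: measurable_funTS.
have mgab : measurable_fun `[a, b] (EFin \o g).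
  by apply/measurable_EFinP; exact: measurable_funTS.
have -> : \int[mu]_(s in `[a, b]) (g s)%:E + (e * (b - a))%:E =
    \int[mu]_(s in `[a, b]) (g s + e)%:E.
  under [RHS]eq_integral do rewrite EFinD.
  rewrite ge0_integralD//; last 2 first.
    by move=> *; rewrite lee_fin.
    by move=> *; rewrite lee_fin ltW.
  by rewrite integral_cst//= muab EFinM.
have tE : trivIset setT E.
  apply/trivIsetP => i j _ _ ij; rewrite -subset0 => s [[_ /= /andP[i1 i2]] [_ /= /andP[j1 j2]]].
  have key : forall k l, (k < l)%N -> (c k <= c l - e)%R.
    move=> k l kl; rewrite /c -[X in (_ - X)%R]mul1r -mulrBl ler_pM2r//.
    by rewrite -[in leRHS]natr1 addrK ler_nat.
  case: (ltngtP i j) ij => // /key ij _.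
    by have := lt_le_trans i2 (le_trans ij j1); rewrite ltxx.
  by have := lt_le_trans j2 (le_trans ij i1); rewrite ltxx.
have UEab : \bigcup_n E n `<=` `[a, b] by move=> s [n _ []].
apply: (@le_trans _ _ (\int[mu]_(s in \bigcup_n E n) (g s + e)%:E)); last first.
  apply: ge0_subset_integral => //; first by apply: bigcup_measurable => n _; exact: mE.
  by move=> s _; rewrite lee_fin addr_ge0// ltW.
rewrite ge0_integral_bigcup//; last 2 first.
  exact: measurable_funS mge.
  by move=> s _; rewrite lee_fin addr_ge0// ltW.
apply: lee_nneseries => [n _ _|n _]; first by rewrite mule_ge0// lee_fin ltW.
have <- : \int[mu]_(x in E n) cst (c n)%:E x = (c n)%:E * mu (E n).
  by rewrite integral_cst//; exact: mE.
apply: ge0_le_integral.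
- exact: mE.
- by move=> s _; rewrite lee_fin ltW.
- exact: measurable_cst.
- by apply: measurable_funS mge => // x [].
- move=> s [_ /= /andP[h _]]; rewrite lee_fin; lra.
Qed.

End le_integral_derive.

(** * Exchanging expectation and derivative *)

Section mean_derive.
Local Open Scope ereal_scope.
Context (R : realType).
Local Notation mu := (@lebesgue_measure R).

(** Cauchy-Schwarz, obtained from the increment bound with the majorant [c / 2 + df ^+ 2 / (2 * c)]
    of [|df|], which also covers an infinite integral. *)
Lemma sqr_increment_le_integral (f df : R -> R) (h : R) : (0 < h)%R ->
  (forall s, is_derive s (1 : R)%R f (df s)) -> measurable_fun setT df ->
  ((f h - f 0%R) ^+ 2)%:E <= h%:E * \int[mu]_(s in `[0%R, h]) (df s ^+ 2)%:E.
Proof.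
move=> h0 fdf mdf.
have [->|fne] := eqVneq (f h - f 0)%R 0%R.
  rewrite expr0n/=; apply: mule_ge0; first by rewrite lee_fin ltW.
  by apply: integral_ge0 => s _; rewrite lee_fin sqr_ge0.
have mdf2 : measurable_fun setT (fun s => df s ^+ 2)%R by exact: measurable_funX.
(* With [c] the mean slope, the increment bound reads [2 c^2 h <= c^2 h + b], where [b] is the
   integral of [df ^+ 2]; hence [c^2 h <= b]. *)
have [c c0 cE] : exists2 c, (0 < c)%R & (`|f h - f 0| = c * h)%R.
  exists (`|f h - f 0| / h)%R; first by rewrite divr_gt0// normr_gt0.
  by rewrite divfK// gt_eqF.
have cM y : (2 * c * (c / 2 + (2 * c)^-1 * y) = c ^+ 2 + y)%R.
  by field; rewrite gt_eqF.
have /= := @abs_increment_le_integral _ f df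
  (fun s => c / 2 + (2 * c)^-1 * (df s ^+ 2))%R 0%R h (ltW h0) fdf.
have aff (a b : R) : (0 <= a)%R -> (0 <= b)%R ->
    \int[mu]_(s in `[0%R, h]) (a + b * (df s ^+ 2))%:E =
    (a * h)%:E + b%:E * \int[mu]_(s in `[0%R, h]) (df s ^+ 2)%:E.
  move=> a0 b0; under eq_integral do rewrite EFinD EFinM.
  have m2 : measurable_fun `[0%R, h] (fun s => (df s ^+ 2)%:E).
    by apply/measurable_EFinP; exact: measurable_funTS.
  have ge2 s : 0 <= (df s ^+ 2)%:E by rewrite lee_fin sqr_ge0.
  rewrite ge0_integralD//.
  - rewrite ge0_integralZl// integral_cst//= lebesgue_measure_itv/= lte_fin h0.
    by rewrite oppr0 adde0 EFinM.
  - by move=> s _; rewrite mule_ge0// lee_fin.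
  - by apply: measurable_funeM.
rewrite aff; [|by rewrite divr_ge0// ltW|by rewrite invr_ge0 mulr_ge0// ltW].
have := @integral_ge0 _ _ _ mu `[0%R, h] (fun s => (df s ^+ 2)%:E)
  (fun s _ => sqr_ge0 (df s)).
case: (\int[mu]_(s in `[0%R, h]) (df s ^+ 2)%:E) => [b| |]//.
- rewrite -EFinM -EFinD !lee_fin => b0 H.
  have : (`|f h - f 0| <= c / 2 * h + (2 * c)^-1 * b)%R.
    apply: H.
      apply: measurable_funD => //.
      exact: measurable_funM.
    move=> s; rewrite -(ler_pM2l (_ : 0 < 2 * c)%R) ?mulr_gt0//.
    rewrite cM -(real_normK (num_real (df s))).
    have := sqr_ge0 (c - `|df s|)%R; nra.
  rewrite cE -(real_normK (num_real (f h - f 0)%R)) cE => H1.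
  have {}H1 : (c ^+ 2 * h <= b)%R.
    have c2 : (0 <= 2 * c)%R by rewrite mulr_ge0// ltW.
    move: H1 => /(ler_wpM2l c2).
    have -> : (2 * c * (c / 2 * h + (2 * c)^-1 * b) = c ^+ 2 * h + b)%R.
      by field; rewrite gt_eqF.
    nra.
  rewrite exprMn; have -> : (c ^+ 2 * h ^+ 2 = h * (c ^+ 2 * h))%R by ring.
  by rewrite ler_pM2l.
- by move=> _ _; rewrite gt0_muley ?lte_fin// leey.
Qed.

Lemma integrable_bounded_sqr (d : measure_display) (T : measurableType d)
    (P : probability T R) (u : T -> R) (C : R) : measurable_fun setT u ->
  \int[P]_v (u v ^+ 2)%:E <= C%:E -> P.-integrable setT (EFin \o u).
Proof.
move=> mu_ u2.
have i2 : P.-integrable setT (fun v => (u v ^+ 2)%:E).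
  apply/integrableP; split; first by apply/measurable_EFinP; exact: measurable_funX.
  under eq_integral do rewrite gee0_abs ?lee_fin ?sqr_ge0//.
  by rewrite (le_lt_trans u2)// ltry.
have : P.-integrable setT (fun v => (1 + u v ^+ 2)%:E).
  under eq_fun do rewrite EFinD.
  by apply: integrableD => //; exact: finite_measure_integrable_cst.
apply: le_integrable => //; first exact/measurable_EFinP.
move=> v _ /=; rewrite lee_fin -(real_normK (num_real (u v))).
rewrite [leRHS]ger0_norm ?addr_ge0 ?sqr_ge0//.
have := sqr_ge0 (`|u v| - 1)%R; have := normr_ge0 (u v); nra.
Qed.

(** Bounded second moments give uniform integrability: the distance [|g - Q n|] truncated at [K]
    vanishes in mean by dominated convergence, and the excess over [K] is small uniformly in [n]. *)
Lemma integral0_limit_bounded_sqr (d : measure_display) (T : measurableType d)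
    (P : probability T R) (Q : nat -> T -> R) (g : T -> R) (C : R) :
  (forall n, measurable_fun setT (Q n)) ->
  (forall v, Q ^~ v @ \oo --> g v) ->
  (forall n, \int[P]_v (Q n v ^+ 2)%:E <= C%:E) ->
  \int[P]_v (g v ^+ 2)%:E <= C%:E ->
  (forall n, \int[P]_v (Q n v)%:E = 0) ->
  \int[P]_v (g v)%:E = 0.
Proof.
move=> mQ Qg Q2 g2 Q0.
have mg : measurable_fun setT g.
  by apply: (measurable_fun_cvg (h := Q)) => // v _; exact: Qg.
have C0 : (0 <= C)%R.
  by rewrite -lee_fin (le_trans _ g2)// integral_ge0// => v _; rewrite lee_fin sqr_ge0.
have ig := integrable_bounded_sqr mg g2.
apply/eqP; rewrite -abse_eq0 eq_le abse_ge0 andbT; apply/lee_addgt0Pr => e e0.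
rewrite add0e.
(* The tail then costs [(2 / K) * 2C = (e / 2) * C / (C + 1)], at most [e / 2]; the summand 1 keeps
   [K] positive when [C = 0]. *)
pose K := (8 * (C + 1) / e)%R.
have K0 : (0 < K)%R by rewrite divr_gt0// mulr_gt0// ltr_wpDl.
pose Y n v := `|g v - Q n v|%R.
have mY n : measurable_fun setT (Y n).
  by apply: measurableT_comp => //; exact: measurable_funB.
have mm n : measurable_fun setT (fun v => Num.min (Y n v) K).
  exact: measurable_minr.
have lim0 : \int[P]_v (Num.min (Y n v) K)%:E @[n --> \oo] --> 0.
  rewrite -(integral0 P setT).
  apply: (@dominated_cvg _ _ _ P setT measurableT
    (fun n v => (Num.min (Y n v) K)%:E) (cst 0) (cst K%:E)) => //.
  - by move=> n; exact/measurable_EFinP.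
  - move=> v _; apply/cvg_EFin; first by near=> n.
    rewrite /comp/=; apply: (@squeeze_cvgr _ _ _ _ (fun=> 0%R) (Y ^~ v)).
    + by near=> n; rewrite le_min normr_ge0 (ltW K0) ge_min lexx.
    + exact: cvg_cst.
    + rewrite -(normr0 R) -(subrr (g v)); apply: cvg_norm.
      by apply: cvgB; [exact: cvg_cst|exact: Qg].
  - exact: finite_measure_integrable_cst.
  - by move=> n v _; rewrite /= lee_fin ger0_norm ?ge_min ?lexx ?orbT// le_min normr_ge0 ltW.
have [n Hn] : exists n, \int[P]_v (Num.min (Y n v) K)%:E <= (e / 2)%:E.
  have : \forall n \near \oo, \int[P]_v (Num.min (Y n v) K)%:E < (e / 2)%:E.
    apply: (lim0 [set y | y < (e / 2)%:E]).
    by apply: open_ereal_lt'; rewrite lte_fin divr_gt0.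
  by move=> [n _ /(_ n (leqnn n)) /= /ltW ?]; exists n.
have iQ := integrable_bounded_sqr (mQ n) (Q2 n).
have -> : \int[P]_v (g v)%:E = \int[P]_v (g v - Q n v)%:E.
  under [RHS]eq_integral do rewrite EFinB.
  by rewrite integralB// Q0 sube0.
apply: (le_trans (le_abse_integral _ _ _)) => //.
  by apply/measurable_EFinP; exact: measurable_funB.
apply: (@le_trans _ _ (\int[P]_v ((Num.min (Y n v) K)%:E +
   (2 / K)%:E * ((Q n v ^+ 2)%:E + (g v ^+ 2)%:E)))).
  apply: ge0_le_integral => //.
  - by apply/measurable_EFinP; exact: mY.
  - apply: emeasurable_funD; first exact/measurable_EFinP.
    apply: measurable_funeM; apply: emeasurable_funD;
      by apply/measurable_EFinP; exact: measurable_funX.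
  - move=> v _; rewrite [leRHS](_ : _ = (Num.min (Y n v) K +
      2 / K * (Q n v ^+ 2 + g v ^+ 2))%:E)// lee_fin -/(Y n v).
    have [YK|KY] := leP (Y n v) K.
      by rewrite lerDl mulr_ge0 ?addr_ge0 ?sqr_ge0// divr_ge0// ltW.
    (* Beyond the truncation level, [K * Y <= Y^2 <= 2 * (Q^2 + g^2)]. *)
    apply: ler_wpDl; first exact: ltW.
    rewrite mulrAC ler_pdivlMr//.
    apply: (@le_trans _ _ (Y n v ^+ 2)%R).
      by rewrite expr2; apply: ler_wpM2l; [exact: normr_ge0|exact: ltW].
    rewrite real_normK ?num_real//.
    have := sqr_ge0 (g v + Q n v)%R; nra.
have mX2 (u : T -> R) : measurable_fun setT u -> measurable_fun setT (fun v : T => (u v ^+ 2)%:E).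
  by move=> mu_; apply/measurable_EFinP; exact: measurable_funX.
have s0 (u : T -> R) v : 0 <= (u v ^+ 2)%:E by rewrite lee_fin sqr_ge0.
have K2 : (0 <= 2 / K)%R by rewrite divr_ge0// ltW.
rewrite ge0_integralD//; last 4 first.
- by move=> v _; rewrite lee_fin le_min normr_ge0 ltW.
- exact/measurable_EFinP.
- by move=> v _; rewrite mule_ge0 ?adde_ge0// lee_fin.
- by apply: measurable_funeM; apply: emeasurable_funD; exact: mX2.
rewrite ge0_integralZl//; last 2 first.
- by apply: emeasurable_funD; exact: mX2.
- by move=> v _; rewrite adde_ge0.
rewrite ge0_integralD//; [|exact: mX2..].
apply: (@le_trans _ _ ((e / 2)%:E + (2 / K)%:E * (C%:E + C%:E))).
  by rewrite leeD// lee_wpmul2l ?lee_fin// leeD.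
rewrite [leLHS](_ : _ = (e / 2 + 2 / K * (C + C))%:E)// lee_fin /K.
have -> : (2 / (8 * (C + 1) / e) * (C + C) = e / 2 * (C / (C + 1)))%R.
  have e1 : e != 0%R by rewrite gt_eqF.
  have C1 : (C + 1)%R != 0%R by rewrite gt_eqF// ltr_wpDl.
  by field; rewrite e1 C1.
have : (C / (C + 1) <= 1)%R by rewrite ler_pdivrMr ?mul1r; lra.
nra.
Unshelve. all: by end_near.
Qed.

(** The difference quotients of [phi] at 0 have mean zero. Their second moments are at most the
    average over [[0, h]] of those of [dphi], hence at most [C], so the mean passes to the limit. *)
Lemma integral_derive0_eq0 (d : measure_display) (T : measurableType d)
    (P : probability T R) (phi dphi : R -> T -> R) (C : R) :
  (forall v s, is_derive s (1 : R)%R (phi ^~ v) (dphi s v)) ->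
  (forall s, P.-integrable setT (EFin \o phi s)) ->
  (forall s, \int[P]_v (phi s v)%:E = 0) ->
  measurable_fun setT (fun z : T * measurableTypeR R => dphi z.2 z.1) ->
  (forall s, \int[P]_v (dphi s v ^+ 2)%:E <= C%:E) ->
  \int[P]_v (dphi 0%R v)%:E = 0.
Proof.
move=> phid iphi phi0 mdphi dphi2.
pose h n : R := n.+1%:R^-1%R.
have h0 n : (0 < h n)%R by rewrite invr_gt0.
have mphi s : measurable_fun setT (phi s).
  by have /measurable_int/measurable_EFinP := iphi s.
have iB n : P.-integrable setT (EFin \o (fun v => (phi (h n) v - phi 0%R v)%R)).
  rewrite (_ : _ \o _ = (EFin \o phi (h n)) \- (EFin \o phi 0%R))//.
  exact: integrableB.
have mdphi1 v : measurable_fun setT (dphi ^~ v).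
  exact: (measurableT_comp mdphi (pair1_measurable v)).
apply: (@integral0_limit_bounded_sqr _ _ P
  (fun n v => (h n)^-1 * (phi (h n) v - phi 0 v))%R _ C).
- by move=> n; apply: measurable_funM => //; exact: measurable_funB.
- move=> v; have [df dl] := phid v 0%R.
  have : h^-1 *: ((phi^~ v \o shift 0) (h *: 1) - phi 0 v)%R @[h --> (0 : R)%R^'] --> dphi 0%R v.
    by rewrite -dl; exact: df.
  move=> /cvgrPdist_lt H; apply/cvgrPdist_lt => e e0.
  have /nbhs_ballP[r /= r0 Hr] := H e e0.
  near=> n.
  have := Hr (h n); rewrite /ball/= sub0r normrN gtr0_norm//.
  rewrite /GRing.scale/= mulr1 addr0; apply; last by rewrite gt_eqF.
  by near: n; exact: near_infty_natSinv_lt (PosNum r0).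
- move=> n.
  (* The cut-off by the indicator turns the integral over [[0, h n]] into one over the whole line,
     so that Tonelli applies on the product space. *)
  pose G (z : T * measurableTypeR R) := ((dphi z.2 z.1) ^+ 2 * \1_`[0%R, h n] z.2)%:E.
  have mG : measurable_fun setT G.
    apply/measurable_EFinP; apply: measurable_funM; first exact: measurable_funX.
    by apply: measurableT_comp => //; exact: measurable_indic.
  have G0 z : 0 <= G z by rewrite lee_fin mulr_ge0// sqr_ge0.
  have GE v : \int[mu]_(s in `[0%R, h n]) (dphi s v ^+ 2)%:E = \int[mu]_s G (v, s).
    by rewrite integral_mkcond epatch_indic; apply: eq_integral => s _; rewrite /G/= EFinM.
  apply: (@le_trans _ _ (\int[P]_v ((h n)^-1%:E * \int[mu]_s G (v, s)))).
    apply: ge0_le_integral => //.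
    + by move=> v _; rewrite lee_fin sqr_ge0.
    + apply/measurable_EFinP; apply: measurable_funX; apply: measurable_funM => //.
      exact: measurable_funB.
    + by apply: measurable_funeM; exact: (measurable_fun_fubini_tonelli_F G).
    + move=> v _; rewrite exprMn EFinM.
      have := sqr_increment_le_integral (h0 n) (phid v) (mdphi1 v).
      rewrite GE => H.
      have -> : ((h n)^-1)%:E * \int[mu]_s G (v, s) =
          ((h n)^-1 ^+ 2)%:E * ((h n)%:E * \int[mu]_s G (v, s)).
        by rewrite muleA -EFinM expr2 mulfVK// gt_eqF.
      by rewrite lee_wpmul2l// lee_fin sqr_ge0.
  rewrite ge0_integralZl//; last 3 first.
  + exact: (measurable_fun_fubini_tonelli_F G).
  + by move=> v _; apply: integral_ge0.
  + by rewrite lee_fin invr_ge0 ltW.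
  rewrite (fubini_tonelli G)//.
  have C0 : (0 <= C)%R.
    by rewrite -lee_fin (le_trans _ (dphi2 0%R))// integral_ge0// => v _; rewrite lee_fin sqr_ge0.
  (* [C] is rewritten as its own average, to be compared pointwise in [s] after the exchange of
     integrals. *)
  have -> : C%:E = ((h n)^-1)%:E * \int[mu]_(s in `[0%R, h n]) C%:E.
    rewrite integral_cst//= lebesgue_measure_itv/= lte_fin h0 oppr0 adde0.
    by rewrite -!EFinM mulrCA mulVf ?mulr1// gt_eqF.
  apply: lee_wpmul2l; first by rewrite lee_fin invr_ge0 ltW.
  rewrite [leRHS]integral_mkcond epatch_indic.
  apply: ge0_le_integral => //.
  + by move=> s _; apply: integral_ge0.
  + exact: (measurable_fun_fubini_tonelli_G G).
  + by apply: emeasurable_funM => //; apply/measurable_EFinP; exact: measurable_indic.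
  + move=> s _; rewrite /G/= indicE; case: (s \in _) => /=.
      by under eq_integral do rewrite mulr1; rewrite mule1.
    by under eq_integral do rewrite mulr0; rewrite mule0 integral0.
- exact: dphi2.
- move=> n; under eq_integral do rewrite EFinM.
  rewrite (integralZl measurableT (iB n)).
  by rewrite (integralB_EFin measurableT (iphi (h n)) (iphi 0%R)) !phi0 sube0 mule0.
Unshelve. all: by end_near.
Qed.

End mean_derive.

(** * Joint measurability *)

Section caratheodory.
Context (R : realType) (d1 d2 : measure_display) (T1 : measurableType d1)
  (T2 : measurableType d2) (n : nat).

(* The countable type C has no sigma-algebra here: the measurability of c is that
   of its fibers. *)
Lemma measurable_fun_discrete (C : countType) (c : T1 -> C)
    (G : C -> T2 -> R) :
  (forall a, measurable [set t | c t = a]) ->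
  (forall a, measurable_fun setT (G a)) ->
  measurable_fun setT (fun z : T1 * T2 => G (c z.1) z.2).
Proof.
move=> mc mG _ B mB; rewrite setTI.
have -> : (fun z : T1 * T2 => G (c z.1) z.2) @^-1` B =
    \bigcup_k (if unpickle k is Some a then
      [set t | c t = a] `*` (G a @^-1` B) else set0).
  apply/seteqP; split=> [[t v] /= Bz|[t v] [k _]].
    by exists (pickle (c t)) => //; rewrite pickleK.
  by case: (unpickle k) => // a [/= ->].
apply: bigcupT_measurable => k; case: (unpickle k) => // a.
apply: measurableX => //; rewrite -[X in measurable X]setTI.
exact: mG.
Qed.

(** Rounding [y] down to a grid of mesh [1 / (k + 1)] leaves countably many values, for which
    measurability is clear; continuity in the first argument gives the limit. *)
Lemma measurable_fun_caratheodory (F : 'rV[R]_n -> T2 -> R) (y : T1 -> 'rV[R]_n) :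
  (forall j, measurable_fun setT (fun t => y t 0 j)) ->
  (forall x, measurable_fun setT (F x)) ->
  (forall v, continuous (F ^~ v)) ->
  measurable_fun setT (fun z : T1 * T2 => F (y z.1) z.2).
Proof.
move=> my mF cF.
(* Integer grid coordinates, in a countable type; [u k] converts them back to a vector. *)
pose c k t : {ffun 'I_n -> int} := [ffun j => Num.floor (k.+1%:R * y t 0 j)].
pose u k (a : {ffun 'I_n -> int}) : 'rV[R]_n := \row_j ((a j)%:~R / k.+1%:R).
have approx k t j : `|y t 0 j - u k (c k t) 0 j| < k.+1%:R^-1.
  rewrite !mxE ffunE.
  have /andP[] := floor_itv (k.+1%:R * y t 0 j).
  set m := Num.floor _; rewrite intrD => h1 h2.
  have k0 : 0 < k.+1%:R :> R by [].
  rewrite ger0_norm; last by rewrite subr_ge0 ler_pdivrMr// mulrC.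
  rewrite -(ltr_pM2l k0) mulrBr divff ?gt_eqF// [_ * (_ / _)]mulrC divfK ?gt_eqF//.
  by rewrite ltrBlDl.
apply: (measurable_fun_cvg (h := fun k (z : T1 * T2) => F (u k (c k z.1)) z.2)) => //.
- move=> k; apply: (@measurable_fun_discrete _ (c k) (fun a => F (u k a))) => //.
  move=> a; have -> : [set t | c k t = a] =
      \bigcap_(j in [set: 'I_n]) [set t | (a j)%:~R <= k.+1%:R * y t 0 j < (a j + 1)%:~R].
    apply/seteqP; split=> t /=.
      by move=> <- j _ /=; rewrite ffunE floor_itv.
    move=> H; apply/ffunP => j; rewrite ffunE; apply/floor_def; exact: H.
  apply: fin_bigcap_measurable => // j _.
  have -> : [set t | (a j)%:~R <= k.+1%:R * y t 0 j < (a j + 1)%:~R] =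
      setT `&` (fun t => k.+1%:R * y t 0 j) @^-1` `[(a j)%:~R, (a j + 1)%:~R[.
    by rewrite setTI; apply/seteqP; split=> t /=; rewrite in_itv.
  have : measurable_fun setT (fun t => k.+1%:R * y t 0 j) by exact: measurable_funM.
  exact.
- move=> [t v] _ /=; apply: (cvg_comp (fun k => u k (c k t)) (F ^~ v)); last exact: cF.
  apply/cvg_ballP => e e0.
  near=> k; split=> // i j; rewrite ord1 /ball/= (lt_trans (approx _ _ _))//.
  by near: k; exact: near_infty_natSinv_lt (PosNum e0).
Unshelve. all: by end_near.
Qed.

End caratheodory.

Lemma enorm_sqr (R : realType) (n : nat) (v : 'rV[R]_n) : enorm v ^+ 2 = dotp v v.
Proof.
by rewrite sqr_sqrtr//; apply: sumr_ge0 => j _; rewrite -expr2 sqr_ge0.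
Qed.

Lemma subr_rowE (R : realType) (n : nat) (u v : 'rV[R]_n) j :
  (u - v) 0 j = u 0 j - v 0 j.
Proof. by rewrite !mxE. Qed.

(** * Directional derivatives and gradients *)

Section directional.
Context (R : realType) (n : nat).

Lemma is_derive_line (f : 'rV[R]_n -> R) (x e : 'rV[R]_n) (s : R) :
  derivable f (x + s *: e) e ->
  is_derive s (1 : R) (fun s => f (x + s *: e)) ('D_e f (x + s *: e)).
Proof.
have E : (fun h : R => h^-1 *: (((fun s => f (x + s *: e)) \o shift s) (h *: (1 : R)) -
      f (x + s *: e))) = (fun h : R => h^-1 *: ((f \o shift (x + s *: e)) (h *: e) - f (x + s *: e))).
  apply/funext => h /=; congr (_ *: (f _ - _)).
  have -> : h *: (1 : R) = h by exact: mulr1.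
  by rewrite scalerDl addrCA.
by move=> df; split; rewrite ?/derivable ?/derive E.
Qed.

(** The derivative as the limit of a sequence: measurability and inequalities both pass to such
    limits. *)
Lemma cvg_difference_quotient (f : 'rV[R]_n -> R) (x e : 'rV[R]_n) :
  derivable f x e ->
  (fun k => k.+1%:R * (f (x + k.+1%:R^-1 *: e) - f x)) @ \oo --> 'D_e f x.
Proof.
move=> /cvgrPdist_lt H; apply/cvgrPdist_lt => r r0.
have /nbhs_ballP[b /= b0 Hb] := H r r0.
near=> k.
have := Hb (k.+1%:R^-1); rewrite /ball/= sub0r normrN gtr0_norm ?invr_gt0//.
rewrite invrK ![_ *: e + x]addrC; apply; last by rewrite gt_eqF ?invr_gt0.
by near: k; exact: near_infty_natSinv_lt (PosNum b0).
Unshelve. all: by end_near.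
Qed.

Lemma derive_gradient (f : 'rV[R]_n -> R) (x v : 'rV[R]_n) :
  differentiable f x -> 'D_v f x = dotp (gradient f x) v.
Proof.
move=> df; rewrite deriveE// {1}(row_sum_delta v) raddf_sum/= /dotp.
by apply: eq_bigr => j _; rewrite linearZ/= mxE deriveE// mulrC.
Qed.

Lemma measurable_fun_gradient (d1 d2 : measure_display) (T1 : measurableType d1)
    (T2 : measurableType d2) (F : 'rV[R]_n -> T2 -> R) (y : T1 -> 'rV[R]_n) (j : 'I_n) :
  (forall i, measurable_fun setT (fun t => y t 0 i)) ->
  (forall x, measurable_fun setT (F x)) ->
  (forall v x, differentiable (F ^~ v) x) ->
  measurable_fun setT (fun z : T1 * T2 => gradient (F ^~ z.2) (y z.1) 0 j).
Proof.
move=> my mF dF.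
have cF v : continuous (F ^~ v) by move=> x; exact: differentiable_continuous.
apply: (measurable_fun_cvg (h := fun k (z : T1 * T2) =>
  k.+1%:R * (F (y z.1 + k.+1%:R^-1 *: delta_mx 0 j) z.2 - F (y z.1) z.2))) => //.
- move=> k; apply: measurable_funM => //; apply: measurable_funB;
    last exact: (measurable_fun_caratheodory (y := y)).
  apply: (measurable_fun_caratheodory (y := fun t => y t + k.+1%:R^-1 *: delta_mx 0 j)) => // i.
  by under eq_fun do rewrite mxE; exact: measurable_funD.
- move=> z _; rewrite mxE; apply: (@cvg_difference_quotient (F ^~ z.2)).
  exact: diff_derivable.
Unshelve. all: by end_near.
Qed.

End directional.

(** * Unbiasedness of the stochastic gradient *)

Section unbiased.
Context (R : realType) (n : nat) (d : measure_display) (T : measurableType d).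
Variables (D : probability T R) (F : 'rV[R]_n -> T -> R) (delta : R).
Hypothesis iF : forall x, D.-integrable setT (fun v => (F x v)%:E).
Hypothesis dF : forall v x, differentiable (F ^~ v) x.
Hypothesis df : forall x, differentiable (local_cost F D) x.
Hypothesis vF : bounded_variance F D delta.

Let mF x : measurable_fun setT (F x).
Proof. by have /measurable_int/measurable_EFinP := iF x. Qed.

Let measurable_gradient_loss x j : measurable_fun setT (fun v => gradient (F ^~ v) x 0 j).
Proof.
have := measurable_fun_gradient (y := fun _ : T => x) j (fun i => measurable_cst (x 0 i)) mF dF.
by move=> /measurableT_comp /(_ (measurable_fun_pair (@measurable_id _ T setT) (@measurable_id _ T setT))).
Qed.

Lemma measurable_gradient_noise_coord x j :
  measurable_fun setT (fun v => gradient (F ^~ v) x 0 j - gradient (local_cost F D) x 0 j).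
Proof. by apply: measurable_funB => //; exact: measurable_gradient_loss. Qed.

Lemma integral_gradient_noise_coord_sqr_le x j :
  (\int[D]_v ((gradient (F ^~ v) x 0 j - gradient (local_cost F D) x 0 j) ^+ 2)%:E
   <= (delta ^+ 2)%:E)%E.
Proof.
apply: le_trans (vF x).
rewrite unlock; apply: ge0_le_integral => //.
- by move=> v _; rewrite lee_fin sqr_ge0.
- apply/measurable_EFinP; apply: measurable_funX; exact: measurable_gradient_noise_coord.
- apply/measurable_EFinP; under eq_fun do rewrite enorm_sqr.
  apply: measurable_sum => i; under eq_fun do rewrite subr_rowE.
  by apply: measurable_funM; apply: measurable_funB => //; exact: measurable_gradient_loss.
- move=> v _; rewrite lee_fin enorm_sqr /dotp (bigD1 j)//=.
  rewrite subr_rowE -expr2 -[X in X <= _]sqrrN opprB lerDl; apply: sumr_ge0 => i _.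
  by rewrite -expr2 sqr_ge0.
Qed.

Lemma integrable_gradient_noise_coord x j :
  D.-integrable setT
    (fun v => (gradient (F ^~ v) x 0 j - gradient (local_cost F D) x 0 j)%:E).
Proof.
exact: integrable_bounded_sqr (measurable_gradient_noise_coord x j)
  (integral_gradient_noise_coord_sqr_le x j).
Qed.

(** On the line [x + s *: e] the centred loss [phi] has mean zero for every [s], and its derivative
    has second moment at most [delta ^+ 2], uniformly in [s]; [integral_derive0_eq0] applies. *)
Lemma integral_gradient_noise_eq0 x j :
  (\int[D]_v (gradient (F ^~ v) x 0 j - gradient (local_cost F D) x 0 j)%:E = 0)%E.
Proof.
pose f := local_cost F D; pose e : 'rV[R]_n := delta_mx 0 j.
(* Integrability of the loss ensures that [fine] in [local_cost] discards no infinite value. *)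
have fE u : (\int[D]_v (F u v)%:E = (f u)%:E)%E.
  by rewrite /f /local_cost unlock fineK//; exact: integrable_fin_num.
pose phi s v := F (x + s *: e) v - f (x + s *: e).
pose dphi s v := gradient (F ^~ v) (x + s *: e) 0 j - gradient f (x + s *: e) 0 j.
have icst (c : R) : (\int[D]_v c%:E = c%:E)%E.
  rewrite -[RHS]mule1 -(probability_setT D); exact: integral_cst.
have ic (c : R) : D.-integrable setT (fun=> c%:E) by exact: finite_measure_integrable_cst.
have := @integral_derive0_eq0 R _ T D phi dphi (delta ^+ 2).
rewrite /dphi; under eq_integral do rewrite scale0r addr0; apply.
- move=> v s; rewrite /phi !mxE; apply: is_deriveB.
    by apply: (@is_derive_line _ _ (F ^~ v)); exact: diff_derivable.
  by apply: is_derive_line; exact: diff_derivable.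
- move=> s; rewrite (_ : _ \o _ = (fun v => (F (x + s *: e) v)%:E) \- (fun=> (f (x + s *: e))%:E))%E//.
  exact: integrableB.
- move=> s; rewrite /phi; under eq_integral do rewrite EFinB.
  by rewrite integralB// fE icst subee.
- have ms i : measurable_fun setT (fun s : measurableTypeR R => (x + s *: e) 0 i).
    by under eq_fun do rewrite 2!mxE; apply: measurable_funD => //; exact: measurable_funM.
  have msw : measurable_fun setT (fun z : T * measurableTypeR R => (z.2, z.1)).
    exact: measurable_fun_pair.
  apply: measurable_funB.
    exact: (measurableT_comp (measurable_fun_gradient
      (y := fun s : measurableTypeR R => x + s *: e) j ms mF dF) msw).
  exact: (measurableT_comp (measurable_fun_gradient (F := fun u (_ : T) => f u)
    (y := fun s : measurableTypeR R => x + s *: e) j ms (fun u => measurable_cst (f u)) (fun _ => df)) msw).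
- by move=> s; exact: integral_gradient_noise_coord_sqr_le.
Qed.

End unbiased.

(** * Integrating out an independent sample *)

Section freezing.
Local Open Scope ereal_scope.
Context (R : realType) (dO dX : measure_display) (Omega : measurableType dO)
  (P : probability Omega R) (Xi : measurableType dX) (D : probability Xi R).
Variables (xi : Omega -> Xi) (G : set (set Omega)).
Hypothesis sG : sigma_algebra setT G.
Hypothesis Gm : G `<=` measurable.
Hypothesis mxi : measurable_fun setT xi.
Hypothesis Pxi : forall A, measurable A -> P (xi @^-1` A) = D A.
Hypothesis indep : indep_of P G xi.

(** [Omega] with the coarser sigma-algebra [G], so that measurability on [OmegaG * Xi] describes
    functions of the past and of the fresh sample. *)
Local Notation OmegaG := (g_sigma_algebraType G).

Let sub (w : Omega) : OmegaG := w.

Let measurable_sub : measurable_fun setT sub.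
Proof.
move=> _ B; rewrite measurable_g_measurableTypeE// setTI => GB.
exact: Gm.
Qed.

Let sub_mixin := isMeasurableFun.Build _ _ _ _ _ measurable_sub.
Let X : {mfun Omega >-> OmegaG} := HB.pack sub sub_mixin.

Let pairxi (w : Omega) : OmegaG * Xi := (w, xi w).

Let measurable_pairxi : measurable_fun setT pairxi.
Proof. exact: measurable_fun_pair. Qed.

Let pairxi_mixin := isMeasurableFun.Build _ _ _ _ _ measurable_pairxi.
Let Z : {mfun Omega >-> (OmegaG * Xi)%type} := HB.pack pairxi pairxi_mixin.

Let PG : probability OmegaG R := distribution P X.

(** Independence is this identity on rectangles, and a product measure is determined by its values
    there. *)
Let law_pairxi A : measurable A -> (PG \x D) A = distribution P Z A.
Proof.
move=> mA; apply: product_measure_unique => // B C mB mC.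
have GB : G B by rewrite -(measurable_g_measurableTypeE sG).
by rewrite /distribution/= /pushforward -Pxi// -indep.
Qed.

Let integral_pairxi (H : OmegaG * Xi -> \bar R) :
  \int[PG \x D]_z H z = \int[distribution P Z]_z H z.
Proof. by apply: eq_measure_integral => A mA _; exact: law_pairxi. Qed.

Lemma ge0_integral_freezing (H : OmegaG * Xi -> \bar R) :
  measurable_fun setT H -> (forall z, 0 <= H z) ->
  \int[P]_w H (w, xi w) = \int[P]_w \int[D]_v H (w, v).
Proof.
move=> mH H0.
transitivity (\int[distribution P Z]_z H z).
  exact/esym/(ge0_integral_distribution Z mH H0).
rewrite -integral_pairxi fubini_tonelli1//.
apply: (ge0_integral_distribution X); first exact: measurable_fun_fubini_tonelli_F.
by move=> w; apply: integral_ge0.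
Qed.

(** The signed version rests on Fubini; integrability along [(w, xi w)] is transferred to the
    product measure through the law of the pair. *)
Lemma integral_freezing_eq0 (H : OmegaG * Xi -> \bar R) :
  measurable_fun setT H -> P.-integrable setT (fun w => H (w, xi w)) ->
  (forall w, \int[D]_v H (w, v) = 0) ->
  \int[P]_w H (w, xi w) = 0.
Proof.
move=> mH iH H0.
transitivity (\int[distribution P Z]_z H z).
  exact/esym/(integral_distribution (X := Z) mH iH).
rewrite -integral_pairxi.
have iH' : (PG \x D).-integrable setT H.
  apply/integrableP; split=> //; rewrite integral_pairxi.
  have -> : \int[distribution P Z]_z `|H z| = \int[P]_w `|H (w, xi w)|.
    by apply: (ge0_integral_distribution Z (f := abse \o H)) => [|z];
      [exact: measurableT_comp|exact: abse_ge0].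
  by case/integrableP: iH.
rewrite -(integral12_prod_meas1 iH').
by apply: integral0_eq => w _; exact: H0.
Qed.

End freezing.

(** * Euclidean and l_p geometry *)

Section dot_product.
Context (R : realType) (n : nat).
Implicit Types (u v w : 'rV[R]_n) (c : R).

Lemma dotpC u v : dotp u v = dotp v u.
Proof. by apply: eq_bigr => j _; rewrite mulrC. Qed.

Lemma dotpDl u v w : dotp (u + v) w = dotp u w + dotp v w.
Proof. by rewrite /dotp -big_split; apply: eq_bigr => j _; rewrite mxE mulrDl. Qed.

Lemma dotpZl c u w : dotp (c *: u) w = c * dotp u w.
Proof. by rewrite /dotp mulr_sumr; apply: eq_bigr => j _; rewrite mxE mulrA. Qed.

Lemma dotpNl u w : dotp (- u) w = - dotp u w.
Proof. by rewrite -scaleN1r dotpZl mulN1r. Qed.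

Lemma dotpDr u v w : dotp w (u + v) = dotp w u + dotp w v.
Proof. by rewrite dotpC dotpDl !(dotpC w). Qed.

Lemma dotpZr c u w : dotp w (c *: u) = c * dotp w u.
Proof. by rewrite dotpC dotpZl (dotpC w). Qed.

Lemma dotpNr u w : dotp w (- u) = - dotp w u.
Proof. by rewrite dotpC dotpNl (dotpC w). Qed.

Lemma dotp0l w : dotp 0 w = 0.
Proof. by rewrite -(scale0r 0) dotpZl mul0r. Qed.

Definition dotpE := (dotpDl, dotpDr, dotpNl, dotpNr, dotpZl, dotpZr).

Lemma dotp_suml (I : finType) (A : {set I}) (f : I -> 'rV[R]_n) w :
  dotp (\sum_(i in A) f i) w = \sum_(i in A) dotp (f i) w.
Proof.
by elim/big_rec2: _ => [|i b a _ <-]; [exact: dotp0l|exact: dotpDl].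
Qed.

Lemma dotp_ge0 u : 0 <= dotp u u.
Proof. by apply: sumr_ge0 => j _; rewrite -expr2 sqr_ge0. Qed.

Lemma dotp_eq0 u : (dotp u u == 0) = (u == 0).
Proof.
apply/eqP/eqP => [/eqP|->]; last exact: dotp0l.
rewrite psumr_eq0 => [/allP H|j _]; last by rewrite -expr2 sqr_ge0.
apply/rowP => j; rewrite mxE; apply/eqP.
by have := H j (mem_index_enum _); rewrite mulf_eq0 orbb.
Qed.

Lemma dotp_delta u j : dotp u (delta_mx 0 j) = u 0 j.
Proof.
rewrite /dotp (bigD1 j)//= mxE !eqxx mulr1 big1 ?addr0// => i ij.
by rewrite mxE (negbTE ij) mulr0.
Qed.

Lemma enorm_ge0 u : 0 <= enorm u. Proof. exact: sqrtr_ge0. Qed.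

Lemma enormZ c u : enorm (c *: u) = `|c| * enorm u.
Proof. by rewrite /enorm !dotpE mulrA sqrtrM -?expr2 ?sqr_ge0// sqrtr_sqr. Qed.

Lemma enormN u : enorm (- u) = enorm u.
Proof. by rewrite /enorm dotpNl dotpNr opprK. Qed.

Lemma enorm_distC u v : enorm (u - v) = enorm (v - u).
Proof. by rewrite -enormN opprB. Qed.

Lemma dotp_le_enorm u v : dotp u v <= enorm u * enorm v.
Proof.
have [v0|v0] := eqVneq (dotp v v) 0.
  have /eqP -> : v == 0 by rewrite -dotp_eq0 v0.
  by rewrite dotpC dotp0l mulr_ge0// enorm_ge0.
have v1 : 0 < dotp v v by rewrite lt_neqAle eq_sym v0 dotp_ge0.
have H : dotp u v ^+ 2 <= dotp u u * dotp v v.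
  (* This vector is [dotp v v] times the component of [u] orthogonal to [v]; its squared norm is
     [dotp v v] times the Cauchy-Schwarz defect. *)
  have := dotp_ge0 (dotp v v *: u - dotp u v *: v).
  rewrite !dotpE (dotpC v u) => H.
  have {}H : 0 <= dotp v v * (dotp u u * dotp v v - dotp u v ^+ 2) by nra.
  by rewrite -subr_ge0 -(pmulr_rge0 _ v1).
rewrite (le_trans (ler_norm _))// -ler_sqr ?nnegrE ?normr_ge0 ?mulr_ge0 ?enorm_ge0//.
by rewrite real_normK ?num_real// exprMn !enorm_sqr.
Qed.

Lemma dotp_le_bound u c : (forall j, `|u 0 j| <= c) -> dotp u u <= c ^+ 2 * n%:R.
Proof.
move=> uc; rewrite mulr_natr -[n in leRHS]card_ord -sumr_const.
apply: ler_sum => j _; rewrite -expr2 -(real_normK (num_real _)).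
by rewrite ler_sqr ?nnegrE// (le_trans _ (uc j)).
Qed.

End dot_product.

Section lpnorm.
Context (R : realType) (n : nat).
Implicit Types (u v : 'rV[R]_n) (p : \bar R).

Lemma lpnorm_ge0 p u : 0 <= lpnorm p u.
Proof.
case: p => [p| |]//=; first exact: powR_ge0.
by apply: bigmax_ge_id.
Qed.

Lemma lpnormZ p c u : (1 <= p)%E -> lpnorm p (c *: u) = `|c| * lpnorm p u.
Proof.
case: p => [p| |]//=; rewrite ?lee_fin => p1.
  have p0 : p != 0 by rewrite gt_eqF// (lt_le_trans _ p1).
  under eq_bigr do rewrite mxE normrM powRM//.
  rewrite -mulr_sumr powRM ?powR_ge0//; last by apply: sumr_ge0 => j _; exact: powR_ge0.
  by rewrite -powRrM divff// powRr1.
under eq_bigr do rewrite mxE normrM.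
elim/big_rec2: _ => [|j x y _ ->]; first by rewrite mulr0.
by rewrite maxr_pMr.
Qed.

Lemma lpnorm_delta p j : (1 <= p)%E -> lpnorm p (delta_mx 0 j : 'rV[R]_n) = 1.
Proof.
case: p => [p| |]//=; rewrite ?lee_fin => p1.
  have p0 : p != 0 by rewrite gt_eqF// (lt_le_trans _ p1).
  rewrite (bigD1 j)//= big1 => [|i ij]; last by rewrite mxE (negbTE ij) normr0 powR0.
  by rewrite mxE !eqxx normr1 addr0 !powR1.
apply/le_anti/andP; split.
  by apply: bigmax_le => // i _; rewrite mxE eqxx/=; case: eqP => _; rewrite ?normr1 ?normr0.
apply: le_trans (le_bigmax _ (fun i => `|(delta_mx 0 j : 'rV[R]_n) 0 i|) j).
by rewrite mxE !eqxx normr1.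
Qed.

(** Minkowski for finite [p], from convexity of the power: [(u + v) / (N + M)] is the convex
    combination of the unit vectors [u / N] and [v / M] with weights [N / (N + M)] and
    [M / (N + M)]. *)
Lemma lpnorm_triangle p u v : (1 <= p)%E ->
  lpnorm p (u + v) <= lpnorm p u + lpnorm p v.
Proof.
case: p => [p| |]//; rewrite ?lee_fin => p1; last first.
  rewrite /=; apply: bigmax_le => [|j _]; first by rewrite addr_ge0// bigmax_ge_id.
  by rewrite mxE (le_trans (ler_normD _ _))// lerD//; apply: le_bigmax_cond.
have p0 : 0 < p by rewrite (lt_le_trans _ p1).
have sum_ge0 (w : 'rV[R]_n) : 0 <= \sum_(j < n) `|w 0 j| `^ p :> R.
  by apply: sumr_ge0 => j _; exact: powR_ge0.
have sumE (w : 'rV[R]_n) : \sum_(j < n) `|w 0 j| `^ p = lpnorm p%:E w `^ p.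
  by rewrite /= -powRrM mulVf ?gt_eqF// powRr1.
have lp0 (w : 'rV[R]_n) : lpnorm p%:E w = 0 -> w = 0.
  move=> w0; have := sumE w; rewrite w0 powR0 ?gt_eqF// => /eqP.
  rewrite psumr_eq0 => [/allP H|j _]; last exact: powR_ge0.
  apply/rowP => j; rewrite mxE; apply/eqP.
  by have := H j (mem_index_enum _); rewrite powR_eq0 normr_eq0 => /andP[].
have [/lp0 ->|u0] := eqVneq (lpnorm p%:E u) 0; first by rewrite add0r lerDr lpnorm_ge0.
have [/lp0 ->|v0] := eqVneq (lpnorm p%:E v) 0; first by rewrite addr0 lerDl lpnorm_ge0.
set N := lpnorm _ u in u0 *; set M := lpnorm _ v in v0 *.
have N0 : 0 < N by rewrite lt_neqAle eq_sym u0 lpnorm_ge0.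
have M0 : 0 < M by rewrite lt_neqAle eq_sym v0 lpnorm_ge0.
have NE : lpnorm p%:E u = N := erefl.
have ME : lpnorm p%:E v = M := erefl.
clearbody N M.
have NM0 : 0 < N + M by exact: addr_gt0.
have step j : `|(u + v) 0 j| `^ p <=
    (N + M) `^ p * (N / (N + M) * (`|u 0 j| `^ p / N `^ p) +
                    M / (N + M) * (`|v 0 j| `^ p / M `^ p)).
  have t01 : 0 <= N / (N + M) <= 1.
    by rewrite (divr_ge0 (ltW N0) (ltW NM0))/= ler_pdivrMr// mul1r lerDl ltW.
  have /andP[t0 t1] := t01.
  have := convex_powR p1 (Itv01 t0 t1) (x := `|u 0 j| / N) (y := `|v 0 j| / M).
  have x0 : 0 <= `|u 0 j| / N by exact: divr_ge0 (normr_ge0 _) (ltW N0).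
  have y0 : 0 <= `|v 0 j| / M by exact: divr_ge0 (normr_ge0 _) (ltW M0).
  rewrite !inE/= !in_itv/= !andbT x0 y0 => /(_ isT isT).
  rewrite convRE/= [X in X `^ _ <= _ -> _]convRE/=.
  have -> : unstable.onem (N / (N + M)) = M / (N + M) :> R.
    by rewrite /unstable.onem; field; rewrite gt_eqF.
  move=> H.
  have uvj : `|(u + v) 0 j| / (N + M) <=
     N / (N + M) * (`|u 0 j| / N) + M / (N + M) * (`|v 0 j| / M).
    have -> : N / (N + M) * (`|u 0 j| / N) + M / (N + M) * (`|v 0 j| / M) =
        (`|u 0 j| + `|v 0 j|) / (N + M).
      by field; rewrite !gt_eqF.
    by rewrite ler_pM2r ?invr_gt0// mxE ler_normD.
  have : (`|(u + v) 0 j| / (N + M)) `^ p <= N / (N + M) * (`|u 0 j| / N) `^ p +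
                    M / (N + M) * (`|v 0 j| / M) `^ p.
    apply: le_trans H; apply: ge0_ler_powR => //; first exact: ltW.
    - by rewrite nnegrE divr_ge0// ltW.
    - by rewrite nnegrE addr_ge0// mulr_ge0// divr_ge0// ltW.
  have pd a b : 0 <= a -> 0 < b -> (a / b) `^ p = a `^ p / b `^ p.
    move=> a0 b0; have bp : b `^ p != 0 by rewrite gt_eqF// powR_gt0.
    apply/(mulIf bp); rewrite divfK// -powRM ?(divr_ge0 a0 (ltW b0)) ?(ltW b0)//.
    by rewrite divfK// gt_eqF.
  by rewrite !pd// ler_pdivrMr ?powR_gt0// mulrC.
rewrite -[leRHS]powRr1; last exact: ltW.
have -> : 1 = p * p^-1 :> R by rewrite divff// gt_eqF.
rewrite powRrM [leLHS]/=; apply: ge0_ler_powR.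
- by rewrite invr_ge0 ltW.
- by rewrite nnegrE.
- by rewrite nnegrE powR_ge0.
apply: (le_trans (ler_sum _ (fun j _ => step j))).
rewrite -mulr_sumr big_split/= -!mulr_sumr -!mulr_suml !sumE NE ME.
by rewrite !divff ?powR_eq0 ?negb_and ?gt_eqF// !mulr1 -mulrDl divff ?gt_eqF// mulr1.
Qed.

Section subgradient.
Variables (p : \bar R) (hp : (1 <= p)%E).

(** Moving [x] by plus or minus a basis vector changes the norm by at most 1, whatever [p] is. Hence
    the squared Euclidean norm of a subgradient is at most the dimension. *)
Lemma subgradient_lpnorm_le1 (c x s : 'rV[R]_n) j :
  is_subgradient (fun u => lpnorm p (u - c)) x s -> `|s 0 j| <= 1.
Proof.
move=> sg; have key e : `|e| = 1 -> e * s 0 j <= 1.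
  move=> e1; have := sg (x + e *: delta_mx 0 j).
  rewrite addrAC subrr add0r dotpZr dotp_delta addrAC => H.
  have := le_trans H (lpnorm_triangle _ _ hp).
  by rewrite lerD2l lpnormZ// lpnorm_delta// e1 mulr1.
rewrite ler_norml -[_ <= s 0 j]lerN2 opprK -[s 0 j in X in _ && X]mul1r -mulN1r.
by rewrite !key ?normrN ?normr1.
Qed.

(** The test points are shifted so that each inequality compares the norms of [x - c] and [y - e];
    adding the two cancels the norms although the centres differ. *)
Lemma subgradient_lpnorm_monotone (x c y e s t : 'rV[R]_n) :
  is_subgradient (fun u => lpnorm p (u - c)) x s ->
  is_subgradient (fun u => lpnorm p (u - e)) y t ->
  0 <= dotp ((x - c) - (y - e)) (s - t).
Proof.
move=> /(_ (c + (y - e))) + /(_ (e + (x - c))).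
have E (a b : 'rV[R]_n) : a + b - a = b by rewrite addrAC subrr add0r.
rewrite !E.
rewrite !dotpE !(dotpC _ x) !(dotpC _ y) !(dotpC _ c) !(dotpC _ e); lra.
Qed.

End subgradient.
End lpnorm.

(** * Strongly convex functions with Lipschitz gradient *)

Section smooth.
Context (R : realType) (n : nat).
Implicit Types (f : 'rV[R]_n -> R) (x y e : 'rV[R]_n).

Lemma cvg_gradient_quotient f x e : differentiable f x ->
  (fun k => k.+1%:R * (f (x + k.+1%:R^-1 *: e) - f x)) @ \oo --> dotp (gradient f x) e.
Proof.
move=> df; rewrite -derive_gradient//; apply: cvg_difference_quotient.
exact: diff_derivable.
Qed.

(** A first-order condition for a smooth plus a convex term: [t * c] bounds the increment of the
    convex term along [t *: e]. *)
Lemma ge0_directional f x e c : differentiable f x ->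
  (forall t, 0 < t -> t <= 1 -> f x <= f (x + t *: e) + t * c) ->
  0 <= dotp (gradient f x) e + c.
Proof.
move=> df H; rewrite -lerBlDr sub0r.
apply: (cvgr_to_ge (cvg_gradient_quotient (e := e) df)).
near=> k; have k0 : 0 < k.+1%:R :> R by [].
have := H k.+1%:R^-1; rewrite invr_gt0 k0 invf_le1// ler1n => /(_ isT isT).
rewrite -(ler_pM2l k0) mulrDr mulrA divff ?gt_eqF// mul1r; lra.
Unshelve. all: by end_near.
Qed.

(** Strong convexity at [t = 1 / (k + 1)], multiplied by [k + 1], yields the claim up to a remainder
    of order [1 / (k + 1)]. *)
Lemma strongly_convex_gradient mu f x y : differentiable f x ->
  strongly_convex mu f ->
  f x + dotp (gradient f x) (y - x) + mu / 2 * enorm (y - x) ^+ 2 <= f y.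
Proof.
move=> df sc; set N := enorm _ ^+ 2.
have H : forall k, k.+1%:R * (f (x + k.+1%:R^-1 *: (y - x)) - f x) + mu / 2 * N <=
    f y - f x + mu / 2 * N * k.+1%:R^-1.
  move=> k; have k0 : 0 < k.+1%:R :> R by [].
  have := sc y x k.+1%:R^-1; rewrite invr_ge0 ltW// invf_le1// ler1n => /(_ isT isT).
  have -> : k.+1%:R^-1 *: y + (1 - k.+1%:R^-1) *: x = x + k.+1%:R^-1 *: (y - x).
    by rewrite scalerBl scale1r scalerBr addrCA.
  rewrite -(ler_pM2l k0) -/N; set h := k.+1%:R^-1.
  have kh : k.+1%:R * h = 1 by rewrite /h divff// gt_eqF.
  have -> : k.+1%:R * (h * f y + (1 - h) * f x - mu / 2 * h * (1 - h) * N) =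
     (k.+1%:R * h) * (f y - f x - mu / 2 * (1 - h) * N) + k.+1%:R * f x by ring.
  rewrite kh; lra.
have : dotp (gradient f x) (y - x) + mu / 2 * N <= f y - f x + mu / 2 * N * 0.
  apply: (ler_cvg_to (cvgD (cvg_gradient_quotient (e := y - x) df) (cvg_cst (mu / 2 * N)))
    (cvgD (cvg_cst (f y - f x)) (cvgM (cvg_cst (mu / 2 * N)) cvg_harmonic))).
  by near=> k; exact: H.
rewrite mulr0 addr0; lra.
Unshelve. all: by end_near.
Qed.

(** The descent lemma by the mean value theorem: on the segment, [psi] is [f] minus its quadratic
    upper model, up to the constant [f x], and its derivative is nonpositive by Cauchy-Schwarz and
    the Lipschitz bound. *)
Lemma lipschitz_gradient_le L f x y : lipschitz_gradient L f ->
  f y <= f x + dotp (gradient f x) (y - x) + L / 2 * enorm (y - x) ^+ 2.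
Proof.
move=> [df lip]; set e := y - x.
pose psi (s : R) := f (x + s *: e) - (s * dotp (gradient f x) e + L / 2 * enorm e ^+ 2 * s ^+ 2).
pose dpsi (s : R) := dotp (gradient f (x + s *: e)) e -
  (dotp (gradient f x) e + L * enorm e ^+ 2 * s).
have dp s : is_derive s (1 : R) psi (dpsi s).
  apply: is_deriveB.
    rewrite -derive_gradient//; apply: is_derive_line; exact: diff_derivable.
  apply: is_derive_eq.
  transitivity (s * 0 + dotp (gradient f x) e * 1 + L / 2 * enorm e ^+ 2 * (s * 1 + s * 1)).
    by [].
  by field.
have [c] : exists2 c, c \in `[0, 1]%R & psi 1 - psi 0 = dpsi c * (1 - 0).
  apply: MVT_segment => //.
  by apply: derivable_within_continuous => s _; apply: ex_derive.
rewrite in_itv/= => /andP[c0 c1]; rewrite subr0 mulr1 => E.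
suff : dpsi c <= 0.
  rewrite -E /psi scale1r scale0r addr0 /e addrCA subrr addr0; lra.
rewrite /dpsi.
have := dotp_le_enorm (gradient f (x + c *: e) - gradient f x) e.
rewrite dotpDl dotpNl => H.
have := lip (x + c *: e) x; rewrite addrAC subrr add0r => H1.
have := ler_wpM2r (enorm_ge0 e) H1; rewrite enormZ ger0_norm//; lra.
Qed.

(** The lower and upper quadratic bounds are compared at a unit vector, which exists only in
    positive dimension. *)
Lemma strongly_convex_le_lipschitz mu L f : (0 < n)%N ->
  strongly_convex mu f -> lipschitz_gradient L f -> mu <= L.
Proof.
move=> n0 sc lip; pose e : 'rV[R]_n := delta_mx 0 (Ordinal n0).
have := strongly_convex_gradient (x := 0) e (lip.1 0) sc.
have := lipschitz_gradient_le 0 e lip.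
have ee : dotp e e = 1 by rewrite /e dotp_delta mxE !eqxx.
rewrite subr0 enorm_sqr ee !mulr1; lra.
Qed.

(* Nesterov, Introductory Lectures on Convex Optimization, Theorem 2.1.12 *)
Lemma strongly_convex_smooth_interpolation mu L f x y : (0 < n)%N ->
  strongly_convex mu f -> lipschitz_gradient L f -> 0 < mu ->
  mu * L * dotp (x - y) (x - y) +
    dotp (gradient f x - gradient f y) (gradient f x - gradient f y) <=
  (mu + L) * dotp (x - y) (gradient f x - gradient f y).
Proof.
move=> n0 sc lip mu0; set a := x - y; set g := gradient f x - gradient f y.
(* Upper and lower quadratic bounds at [x - D] and at [y + D], each expanded from both base points;
   summing the four cancels all values of [f]. *)
have H D : 2 * dotp g D + mu * dotp (a - D) (a - D) - L * dotp D D <= dotp g a.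
  have := strongly_convex_gradient (y + D) (lip.1 x) sc.
  have := strongly_convex_gradient (x - D) (lip.1 y) sc.
  have := lipschitz_gradient_le y (y + D) lip.
  have := lipschitz_gradient_le x (x - D) lip.
  have -> : x - D - x = - D by rewrite addrAC subrr add0r.
  have -> : y + D - y = D by rewrite addrAC subrr add0r.
  have -> : x - D - y = a - D by rewrite addrAC.
  have -> : y + D - x = - (a - D) by rewrite /a; apply/rowP => j; rewrite !mxE; ring.
  rewrite !enorm_sqr /g !dotpE; lra.
have lipag : enorm g <= L * enorm a := lip.2 x y.
clearbody a g.
(* For [mu = L] the optimal [D] below is undefined; [D = 0] and the Lipschitz bound suffice. *)
have := strongly_convex_le_lipschitz n0 sc lip; rewrite le_eqVlt => /predU1P[muL|muL].
  have H1 := H 0.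
  have : dotp g g <= L ^+ 2 * dotp a a.
    rewrite -!enorm_sqr -exprMn ler_sqr ?nnegrE ?mulr_ge0 ?enorm_ge0//; lra.
  move: H1; rewrite subr0 !(dotpC _ 0) !dotp0l (dotpC a g) -muL; nra.
(* The maximizer in [D] of the left-hand side of [H], a concave quadratic since [mu < L]. *)
have := H ((L - mu)^-1 *: (g - mu *: a)).
rewrite !dotpE (dotpC a g).
have Lmu : 0 < L - mu by rewrite subr_gt0.
set A := dotp a a; set B := dotp g a; set C := dotp g g.
move=> H3; have {}H3 : (L - mu) * (mu * A) + (C - 2 * mu * B + mu ^+ 2 * A) <= (L - mu) * B.
  move: H3 => /(ler_wpM2l (ltW Lmu)); apply: le_trans; rewrite le_eqVlt; apply/orP; left; apply/eqP.
  by field; rewrite gt_eqF.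
lra.
Qed.

End smooth.

(** * One step of the iteration *)

Section optimality.
Context (R : realType) (m d : nat) (Reg : {set 'I_m}) (lam : R) (p : \bar R)
  (f : 'I_m -> 'rV[R]_d -> R) (f0 : 'rV[R]_d -> R) (xs : stacked R m d).
Hypothesis hp : (1 <= p)%E.
Hypothesis lam0 : 0 < lam.
Hypothesis df : forall i x, differentiable (f i) x.
Hypothesis df0 : forall x, differentiable f0 x.
Hypothesis hxs : is_minimizer (regularized_cost Reg lam p f f0) xs.

(** Only block [i] is moved, towards [v]; convexity of the norm bounds the penalty increment
    linearly in [t]. *)
Lemma minimizer_subgradient i : i \in Reg ->
  is_subgradient (fun u => lpnorm p (u - xs.2)) (xs.1 i)
    (- lam^-1 *: gradient (f i) (xs.1 i)).
Proof.
move=> iReg v; rewrite dotpZl.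
set N0 := lpnorm p (xs.1 i - xs.2); set N1 := lpnorm p (v - xs.2).
suff : 0 <= dotp (gradient (f i) (xs.1 i)) (v - xs.1 i) + lam * (N1 - N0).
  rewrite -(pmulr_rge0 _ (_ : 0 < lam^-1)) ?invr_gt0// mulrDr mulrA mulVf ?gt_eqF//; lra.
apply: ge0_directional => // t t0 t1.
pose y : stacked R m d := (fun j => if j == i then xs.1 i + t *: (v - xs.1 i) else xs.1 j, xs.2).
have := hxs y; rewrite /regularized_cost (bigD1 i)//= [X in _ <= X + _ -> _](bigD1 i)//= eqxx.
have -> : \sum_(j in Reg | j != i) (f j (if j == i then xs.1 i + t *: (v - xs.1 i) else xs.1 j) +
      lam * lpnorm p ((if j == i then xs.1 i + t *: (v - xs.1 i) else xs.1 j) - xs.2)) =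
    \sum_(j in Reg | j != i) (f j (xs.1 j) + lam * lpnorm p (xs.1 j - xs.2)).
  by apply: eq_bigr => j /andP[_ /negbTE ->].
have NE : lpnorm p (xs.1 i + t *: (v - xs.1 i) - xs.2) <= (1 - t) * N0 + t * N1.
  have -> : xs.1 i + t *: (v - xs.1 i) - xs.2 = (1 - t) *: (xs.1 i - xs.2) + t *: (v - xs.2).
    by apply/rowP => j; rewrite !mxE; ring.
  rewrite (le_trans (lpnorm_triangle _ _ hp))// !lpnormZ// !ger0_norm ?subr_ge0//; exact: ltW.
move: NE => /(ler_wpM2l (ltW lam0)); rewrite -/N0; lra.
Qed.

(** Translating all blocks by the same vector leaves every penalty unchanged, so the smooth part
    alone is stationary in that direction. *)
Lemma minimizer_stationary :
  gradient f0 xs.2 = - \sum_(i in Reg) gradient (f i) (xs.1 i).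
Proof using df df0 hxs.
apply/eqP; rewrite -addr_eq0 addrC; set g := _ + _; rewrite -dotp_eq0.
suff H w : 0 <= dotp g w.
  by rewrite eq_le dotp_ge0 andbT; have := H (- g); rewrite dotpNr oppr_ge0.
pose Q i k := k.+1%:R * (f i (xs.1 i + k.+1%:R^-1 *: w) - f i (xs.1 i)).
have cQ : (fun k => \sum_(i in Reg) Q i k) @ \oo -->
    \sum_(i in Reg) dotp (gradient (f i) (xs.1 i)) w.
  rewrite (_ : (fun k => _) = \sum_(i in Reg) Q i); last by rewrite fct_sumE.
  elim/big_ind2: _ => [|? ? ? ? ? ?|i _]; first exact: cvg_cst.
    exact: cvgD.
  exact: cvg_gradient_quotient.
rewrite /g dotpDl dotp_suml.
apply: (cvgr_to_ge (cvgD cQ (cvg_gradient_quotient (e := w) (df0 xs.2)))).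
near=> k.
suff : 0 <= k.+1%:R * (\sum_(i in Reg) (f i (xs.1 i + k.+1%:R^-1 *: w) - f i (xs.1 i)) +
    (f0 (xs.2 + k.+1%:R^-1 *: w) - f0 xs.2)) by rewrite mulrDr mulr_sumr.
apply: mulr_ge0 => //.
pose y : stacked R m d := (fun j => xs.1 j + k.+1%:R^-1 *: w, xs.2 + k.+1%:R^-1 *: w).
have := hxs y; rewrite /regularized_cost/=.
rewrite [X in _ <= X + _ -> _](eq_bigr (fun j => f j (xs.1 j + k.+1%:R^-1 *: w) +
    lam * lpnorm p (xs.1 j - xs.2))); last first.
  by move=> j _; rewrite opprD addrACA subrr addr0.
rewrite !big_split/= sumrN; lra.
Unshelve. all: by end_near.
Qed.

End optimality.

Section one_step.
Context (R : realType) (n : nat).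
Implicit Types (a g e u v : 'rV[R]_n).

Lemma dotpD_le u v : dotp (u + v) (u + v) <= 2 * dotp u u + 2 * dotp v v.
Proof. have := dotp_ge0 (u - v); rewrite !dotpE (dotpC v u); lra. Qed.

Lemma dotp_am_gm (eps lam : R) u v : 0 < eps ->
  - 2 * lam * dotp u v <= eps * dotp u u + lam ^+ 2 * dotp v v / eps.
Proof.
move=> eps0.
have := dotp_ge0 (eps *: u + lam *: v); rewrite !dotpE (dotpC v u) => H.
rewrite -(ler_pM2l eps0) mulrDr [eps * (_ / eps)]mulrC divfK ?gt_eqF//; lra.
Qed.

(** Interpolation gives the contraction and a spare term in [dotp g g], which pays for the
    [dotp g g] of the squared step because [2 * alpha * (mu + L) <= 1]. For a worker [e] is the
    gradient noise; for the master it is the Byzantine term, with [- lam] in place of [lam]. *)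
Lemma gradient_step_le (mu L alpha lam : R) a g e u :
  0 < mu + L -> 0 <= alpha -> alpha <= 1 / (2 * (mu + L)) ->
  mu * L * dotp a a + dotp g g <= (mu + L) * dotp a g ->
  dotp (a - alpha *: (e + (g + lam *: u))) (a - alpha *: (e + (g + lam *: u))) <=
  (1 - alpha * (2 * mu * L / (mu + L))) * dotp a a - 2 * alpha * dotp a e
  - 2 * alpha * lam * dotp a u + 2 * alpha ^+ 2 * dotp e e
  + 4 * alpha ^+ 2 * lam ^+ 2 * dotp u u.
Proof.
move=> k0; set k := mu + L in k0 *; move=> al0 alk H.
have {}alk : 2 * alpha * k <= 1.
  by move: alk; rewrite ler_pdivlMr ?mulr_gt0//; lra.
set E := e + _.
have E2 : dotp E E <= 2 * dotp e e + 4 * dotp g g + 4 * lam ^+ 2 * dotp u u.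
  have := dotpD_le e (g + lam *: u); have := dotpD_le g (lam *: u).
  rewrite -/E (dotpZl lam) dotpZr; lra.
have Eg : dotp a E = dotp a e + dotp a g + lam * dotp a u by rewrite /E !dotpDr dotpZr; lra.
have -> : dotp (a - alpha *: E) (a - alpha *: E) =
    dotp a a - 2 * alpha * dotp a E + alpha ^+ 2 * dotp E E.
  by clearbody E; rewrite !dotpE (dotpC E a); ring.
rewrite Eg.
have H1 : 2 * alpha * (mu * L / k * dotp a a + dotp g g / k) <= 2 * alpha * dotp a g.
  apply: ler_wpM2l; first by rewrite mulr_ge0.
  rewrite -(ler_pM2l k0) (_ : k * _ = mu * L * dotp a a + dotp g g)//.
  by field; rewrite gt_eqF.
have H2 : 4 * alpha ^+ 2 * dotp g g <= 2 * alpha * (dotp g g / k).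
  have -> : 2 * alpha * (dotp g g / k) = 2 * alpha * dotp g g / k by ring.
  rewrite ler_pdivlMr//.
  have -> : 4 * alpha ^+ 2 * dotp g g * k = 2 * alpha * dotp g g * (2 * alpha * k) by ring.
  by rewrite ler_piMr// !mulr_ge0// dotp_ge0.
have H3 := ler_wpM2l (sqr_ge0 alpha) E2.
clearbody E k.
have -> : (1 - alpha * (2 * mu * L / k)) * dotp a a = dotp a a - 2 * alpha * (mu * L / k * dotp a a) by ring.
move: H1; rewrite mulrDr; lra.
Qed.

(** Pathwise, for arbitrary stochastic gradients [G]. Monotonicity trades the penalty term of each
    worker for one against [a0]; as [w i = - s i], these cancel against the master's. *)
Lemma rsa_step_le (m : nat) (Reg Byz : {set 'I_m}) (lam : R) (p : \bar R)
    (f : 'I_m -> 'rV[R]_n -> R) (f0 : 'rV[R]_n -> R) (mu L : 'I_m -> R)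
    (mu0 L0 eps eta alpha : R) (xs x x' : stacked R m n) (G s w t : 'I_m -> 'rV[R]_n)
    (z : 'I_m -> 'rV[R]_n) :
  (0 < n)%N -> (1 <= p)%E -> 0 < lam ->
  (forall i, 0 < mu i) -> 0 < mu0 ->
  (forall i, strongly_convex (mu i) (f i)) -> strongly_convex mu0 f0 ->
  (forall i, lipschitz_gradient (L i) (f i)) -> lipschitz_gradient L0 f0 ->
  0 < eps ->
  eta <= 2 * mu0 * L0 / (mu0 + L0) - eps ->
  (forall i, i \in Reg -> eta <= 2 * mu i * L i / (mu i + L i)) ->
  0 <= alpha -> alpha <= 1 / (2 * (mu0 + L0)) ->
  (forall i, i \in Reg -> alpha <= 1 / (2 * (mu i + L i))) ->
  is_minimizer (regularized_cost Reg lam p f f0) xs ->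
  (forall i, i \in Reg ->
    is_subgradient (fun u => lpnorm p (u - x.2)) (x.1 i) (s i) /\ w i = - s i) ->
  (forall j, j \in Byz -> is_subgradient (fun u => lpnorm p (u - z j)) x.2 (t j)) ->
  (forall i, i \in Reg -> x'.1 i = x.1 i - alpha *: (G i + lam *: s i)) ->
  x'.2 = x.2 - alpha *: (gradient f0 x.2
     + lam *: (\sum_(i in Reg) w i + \sum_(j in Byz) t j)) ->
  sqdist Reg x' xs <= (1 - eta * alpha) * sqdist Reg x xs
    + (- 2 * alpha) * (\sum_(i in Reg) dotp (x.1 i - xs.1 i) (G i - gradient (f i) (x.1 i)))
    + 2 * alpha ^+ 2 * (\sum_(i in Reg) enorm (G i - gradient (f i) (x.1 i)) ^+ 2)
    + (alpha ^+ 2 * (16 * lam ^+ 2 * #|Reg|%:R * n%:R + 16 * lam ^+ 2 * #|Reg|%:R ^+ 2 * n%:R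
        + 2 * lam ^+ 2 * #|Byz|%:R ^+ 2 * n%:R)
       + alpha * (lam ^+ 2 * #|Byz|%:R ^+ 2 * n%:R / eps)).
Proof.
move=> n0 hp lam0 mugt0 mu00 sc sc0 lip lip0 eps0 eta0 etai al0 alm ali min hs ht hx' hx0'.
have df i y : differentiable (f i) y by exact: (lip i).1.
have df0 y : differentiable f0 y by exact: lip0.1.
pose ss i := - lam^-1 *: gradient (f i) (xs.1 i).
have hss i : i \in Reg -> is_subgradient (fun u => lpnorm p (u - xs.2)) (xs.1 i) (ss i).
  by move=> iR; exact: minimizer_subgradient df min _ iR.
have gss i : gradient (f i) (xs.1 i) = - (lam *: ss i).
  by rewrite /ss scalerA mulrN divff ?gt_eqF// scaleN1r opprK.
have g0ss : gradient f0 xs.2 = lam *: \sum_(i in Reg) ss i.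
  rewrite (minimizer_stationary df df0 min) scaler_sumr -sumrN.
  by apply: eq_bigr => i _; rewrite gss opprK.
clearbody ss.
pose sg i := s i - ss i.
(* The square of this 2, times the 4 of [gradient_step_le], is the 16 of the final constant. *)
have sg2 i j : i \in Reg -> `|sg i 0 j| <= 2.
  move=> iR; rewrite subr_rowE (le_trans (ler_normB _ _))// -[2]/(1 + 1).
  apply: lerD; first exact: (subgradient_lpnorm_le1 hp j (hs i iR).1).
  exact: (subgradient_lpnorm_le1 hp j (hss i iR)).
pose S := \sum_(i in Reg) sg i; pose T := \sum_(j in Byz) t j.
have sum_le (A : {set 'I_m}) (v : 'I_m -> 'rV[R]_n) c j : (forall i, i \in A -> `|v i 0 j| <= c) ->
    `|(\sum_(i in A) v i) 0 j| <= c * #|A|%:R.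
  move=> vc; rewrite summxE (le_trans (ler_norm_sum _ _ _))//.
  by rewrite mulr_natr -sumr_const; apply: ler_sum => i iA; exact: vc.
have S2 : dotp S S <= (2 * #|Reg|%:R) ^+ 2 * n%:R.
  by apply: dotp_le_bound => j; apply: sum_le => i iR; exact: sg2.
have T2 : dotp T T <= (1 * #|Byz|%:R) ^+ 2 * n%:R.
  apply: dotp_le_bound => j; apply: sum_le => i iB.
  exact: (subgradient_lpnorm_le1 hp j (ht i iB)).
pose a i := x.1 i - xs.1 i; pose a0 := x.2 - xs.2.
pose e i := G i - gradient (f i) (x.1 i).
have kgt (m1 L1 : R) (h : 'rV[R]_n -> R) : 0 < m1 -> strongly_convex m1 h ->
    lipschitz_gradient L1 h -> 0 < m1 + L1.
  by move=> m10 h1 h2; have := strongly_convex_le_lipschitz n0 h1 h2; lra.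
have worker i : i \in Reg -> dotp (x'.1 i - xs.1 i) (x'.1 i - xs.1 i) <=
    (1 - eta * alpha) * dotp (a i) (a i) + (- 2 * alpha) * dotp (a i) (e i)
    + 2 * alpha ^+ 2 * dotp (e i) (e i) + 16 * alpha ^+ 2 * lam ^+ 2 * n%:R
    + (- 2 * alpha * lam) * dotp a0 (sg i).
  move=> iR.
  have := gradient_step_le lam (e i) (sg i) (kgt _ _ _ (mugt0 i) (sc i) (lip i)) al0 (ali i iR)
    (strongly_convex_smooth_interpolation (x.1 i) (xs.1 i) n0 (sc i) (lip i) (mugt0 i)).
  have -> : x.1 i - xs.1 i - alpha *:
      (e i + (gradient (f i) (x.1 i) - gradient (f i) (xs.1 i) + lam *: sg i))
      = x'.1 i - xs.1 i.
    by rewrite hx'// gss /e /sg; apply/rowP => j; rewrite !mxE; ring.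
  move=> /le_trans; apply; rewrite -/(a i).
  have := subgradient_lpnorm_monotone (hs i iR).1 (hss i iR).
  have -> : x.1 i - x.2 - (xs.1 i - xs.2) = a i - a0.
    by rewrite /a /a0; apply/rowP => j; rewrite !mxE; ring.
  rewrite -/(sg i) dotpDl dotpNl => mono.
  have sgn : dotp (sg i) (sg i) <= 2 ^+ 2 * n%:R by apply: dotp_le_bound => j; exact: sg2.
  have H1 := ler_wpM2r (mulr_ge0 al0 (dotp_ge0 (a i))) (etai i iR).
  have H2 := mulr_ge0 (mulr_ge0 al0 (ltW lam0)) mono.
  have H3 := ler_wpM2l (mulr_ge0 (sqr_ge0 alpha) (sqr_ge0 lam)) sgn.
  clear - H1 H2 H3; lra.
have master : dotp (x'.2 - xs.2) (x'.2 - xs.2) <=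
    (1 - eta * alpha) * dotp a0 a0 + 2 * alpha * lam * dotp a0 S
    + 2 * alpha ^+ 2 * lam ^+ 2 * dotp T T + 4 * alpha ^+ 2 * lam ^+ 2 * dotp S S
    + alpha * (lam ^+ 2 * dotp T T / eps).
  have := gradient_step_le (- lam) (lam *: T) S (kgt _ _ _ mu00 sc0 lip0) al0 alm
    (strongly_convex_smooth_interpolation x.2 xs.2 n0 sc0 lip0 mu00).
  have -> : x.2 - xs.2 - alpha *: (lam *: T + (gradient f0 x.2 - gradient f0 xs.2 + - lam *: S))
      = x'.2 - xs.2.
    rewrite hx0' g0ss /S /sg sumrB.
    have -> : \sum_(i in Reg) w i = - \sum_(i in Reg) s i.
      by rewrite -sumrN; apply: eq_bigr => i iR; case: (hs i iR).
    by rewrite -/T; apply/rowP => j; rewrite !mxE; ring.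
  move=> /le_trans; apply; rewrite -/a0 dotpZr dotpZl dotpZr.
  (* The [eps] share of [dotp a0 a0] is what [eta] gives up on the master's side; the other share
     becomes [Delta2]. *)
  have amgm := dotp_am_gm lam a0 T eps0.
  have H1 := ler_wpM2r (mulr_ge0 al0 (dotp_ge0 a0)) eta0.
  have H2 := ler_wpM2l al0 amgm.
  clear - H1 H2; lra.
rewrite /sqdist; under eq_bigr do rewrite enorm_sqr.
under [X in _ <= _ * (X + _) + _ + _ + _]eq_bigr do rewrite enorm_sqr.
under [X in _ <= _ + _ + _ * X + _]eq_bigr do rewrite enorm_sqr.
rewrite !enorm_sqr.
have := ler_sum (index_enum _) worker.
rewrite !big_split/= -!mulr_sumr sumr_const.
have -> : \sum_(i in Reg) dotp a0 (sg i) = dotp a0 S.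
  by rewrite dotpC dotp_suml; apply: eq_bigr => i _; rewrite dotpC.
rewrite -[_ *+ #|Reg|]mulr_natr -/a0 /e.
have H1 := ler_wpM2l (mulr_ge0 (sqr_ge0 alpha) (sqr_ge0 lam)) S2.
have H2 := ler_wpM2l (mulr_ge0 (sqr_ge0 alpha) (sqr_ge0 lam)) T2.
have le0 : 0 <= alpha * (lam ^+ 2 / eps).
  by rewrite mulr_ge0// divr_ge0 ?sqr_ge0// ltW.
have H3 := ler_wpM2l le0 T2.
move: master H1 H2 H3; rewrite -/a0; clear; lra.
Qed.

End one_step.

Lemma measurable_dotp (R : realType) (n : nat) (d : measure_display)
    (T : measurableType d) (u v : T -> 'rV[R]_n) :
  (forall j, measurable_fun setT (fun w => u w 0 j)) ->
  (forall j, measurable_fun setT (fun w => v w 0 j)) ->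
  measurable_fun setT (fun w => dotp (u w) (v w)).
Proof. by move=> mu mv; apply: measurable_sum => j; exact: measurable_funM. Qed.

Lemma measurable_enorm_sqr (R : realType) (n : nat) (d : measure_display)
    (T : measurableType d) (u : T -> 'rV[R]_n) :
  (forall j, measurable_fun setT (fun w => u w 0 j)) ->
  measurable_fun setT (fun w => enorm (u w) ^+ 2).
Proof. by move=> mu; under eq_fun do rewrite enorm_sqr; exact: measurable_dotp. Qed.

(** * Gradient noise along the iteration *)

Section gradient_noise.
Context (R : realType) (n : nat) (dO dX : measure_display) (Omega : measurableType dO)
  (P : probability Omega R) (Xi : measurableType dX) (D : probability Xi R).
Variables (xi : Omega -> Xi) (G : set (set Omega)).
Hypothesis sG : sigma_algebra setT G.
Hypothesis Gm : G `<=` measurable.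
Hypothesis mxi : measurable_fun setT xi.
Hypothesis Pxi : forall A, measurable A -> P (xi @^-1` A) = D A.
Hypothesis indep : indep_of P G xi.
Variables (F : 'rV[R]_n -> Xi -> R) (delta : R) (y : Omega -> 'rV[R]_n).
Hypothesis iF : forall x, D.-integrable setT (fun v => (F x v)%:E).
Hypothesis dF : forall v x, differentiable (F ^~ v) x.
Hypothesis df : forall x, differentiable (local_cost F D) x.
Hypothesis vF : bounded_variance F D delta.
Hypothesis my : vec_mfun_wrt G y.

Local Notation OmegaG := (g_sigma_algebraType G).

Let noise (w : Omega) (v : Xi) : 'rV[R]_n :=
  gradient (F ^~ v) (y w) - gradient (local_cost F D) (y w).

Let mF x : measurable_fun setT (F x).
Proof. by have /measurable_int/measurable_EFinP := iF x. Qed.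

Let measurable_y i : measurable_fun setT (fun w : OmegaG => y w 0 i).
Proof. by move=> _ A mA; rewrite setTI; apply: sub_sigma_algebra; exact: my. Qed.

Let measurable_noise j : measurable_fun setT (fun z : OmegaG * Xi => noise z.1 z.2 0 j).
Proof.
under eq_fun do rewrite subr_rowE; apply: measurable_funB.
  exact: (measurable_fun_gradient (y := y : OmegaG -> _)).
exact: (measurable_fun_gradient (F := fun u (_ : Xi) => local_cost F D u) (y := y : OmegaG -> _)).
Qed.

Let measurable_sub : measurable_fun setT (fun w : Omega => (w : OmegaG)).
Proof. by move=> _ B; rewrite measurable_g_measurableTypeE// setTI => GB; exact: Gm. Qed.

Lemma measurable_gradient_noise j :
  measurable_fun setT (fun w => (gradient (F ^~ (xi w)) (y w) - gradient (local_cost F D) (y w)) 0 j).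
Proof.
have mp : measurable_fun setT (fun w : Omega => (w : OmegaG, xi w)).
  exact: measurable_fun_pair.
exact: (measurableT_comp (measurable_noise j) mp).
Qed.

(** With the past frozen, [y w] is a fixed point and the variance bound at that point applies. *)
Lemma integral_gradient_noise_sqr_le :
  (\int[P]_w (enorm (gradient (F ^~ (xi w)) (y w) - gradient (local_cost F D) (y w)) ^+ 2)%:E
   <= (delta ^+ 2)%:E)%E.
Proof.
have := ge0_integral_freezing sG Gm mxi Pxi indep
  (H := fun z : OmegaG * Xi => (enorm (noise z.1 z.2) ^+ 2)%:E) => /= ->.
- apply: (@le_trans _ _ (\int[P]_w (delta ^+ 2)%:E)%E).
    apply: ge0_le_integral => //.
    + by move=> w _; apply: integral_ge0 => v _; rewrite lee_fin sqr_ge0.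
    + have mN : measurable_fun setT (fun z : OmegaG * Xi => (enorm (noise z.1 z.2) ^+ 2)%:E).
        by apply/measurable_EFinP; exact: measurable_enorm_sqr.
      apply: (measurableT_comp (measurable_fun_fubini_tonelli_F (m2 := D) _ mN _)) => //.
      by move=> z; rewrite lee_fin sqr_ge0.
    + move=> w _; apply: le_trans (vF (y w)); rewrite unlock.
      rewrite le_eqVlt; apply/orP; left; apply/eqP; apply: eq_integral => v _.
      by rewrite /noise (enorm_distC (gradient (F ^~ v) (y w))).
  by rewrite integral_cst//= probability_setT mule1.
- by apply/measurable_EFinP; exact: measurable_enorm_sqr.
- by move=> z; rewrite lee_fin sqr_ge0.
Qed.

(** With the past frozen the first factor is constant and each noise coordinate has mean zero.
    Finite second moments of both factors make the product integrable. *)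
Lemma integral_gradient_noise_cross c :
  (\int[P]_w (enorm (y w - c) ^+ 2)%:E < +oo)%E ->
  P.-integrable setT (fun w => (dotp (y w - c)
    (gradient (F ^~ (xi w)) (y w) - gradient (local_cost F D) (y w)))%:E) /\
  (\int[P]_w (dotp (y w - c)
    (gradient (F ^~ (xi w)) (y w) - gradient (local_cost F D) (y w)))%:E = 0)%E.
Proof.
move=> yoo.
have myc j : measurable_fun setT (fun w => (y w - c) 0 j).
  under eq_fun do rewrite subr_rowE; apply: measurable_funB => // _ A mA.
  by rewrite setTI; apply: Gm; exact: my.
have int_sqr (u : Omega -> 'rV[R]_n) : (forall j, measurable_fun setT (fun w => u w 0 j)) ->
    (\int[P]_w (enorm (u w) ^+ 2)%:E < +oo)%E -> P.-integrable setT (fun w => (enorm (u w) ^+ 2)%:E).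
  move=> mu uoo; apply/integrableP; split.
    by apply/measurable_EFinP; exact: measurable_enorm_sqr.
  by under eq_integral do rewrite gee0_abs ?lee_fin ?sqr_ge0//.
have iN := int_sqr _ measurable_gradient_noise (le_lt_trans integral_gradient_noise_sqr_le (ltry _)).
have iy := int_sqr _ myc yoo.
have iH : P.-integrable setT (fun w => (dotp (y w - c)
    (gradient (F ^~ (xi w)) (y w) - gradient (local_cost F D) (y w)))%:E).
  apply: le_integrable (integrableD measurableT iy iN) => //.
    apply/measurable_EFinP; apply: measurable_dotp => //; exact: measurable_gradient_noise.
  move=> w _ /=; rewrite lee_fin [leRHS]ger0_norm ?addr_ge0 ?sqr_ge0// !enorm_sqr.
  set a := y w - c; set e := _ - _; clearbody a e; rewrite ler_norml.
  have := dotp_ge0 (a + e); have := dotp_ge0 (a - e); have := dotp_ge0 a; have := dotp_ge0 e.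
  rewrite !dotpE (dotpC e a) => h1 h2 h3 h4; apply/andP; split; lra.
split=> //.
apply: (integral_freezing_eq0 sG Gm mxi Pxi indep
  (H := fun z : OmegaG * Xi => (dotp (y z.1 - c) (noise z.1 z.2))%:E)) => //.
  apply/measurable_EFinP; apply: measurable_dotp => // j.
  under eq_fun do rewrite subr_rowE; apply: measurable_funB => //.
  exact: (measurableT_comp (measurable_y j) (measurable_fst (T2 := Xi))).
move=> w /=.
have ij j : D.-integrable setT (fun v => (noise w v 0 j)%:E).
  by under eq_fun do rewrite subr_rowE; exact: integrable_gradient_noise_coord dF vF _ _.
have iyj j : D.-integrable setT (fun v => ((y w - c) 0 j)%:E * (noise w v 0 j)%:E)%E.
  exact: integrableZl.
transitivity (\int[D]_v (\sum_(j < n) ((y w - c) 0 j)%:E * (noise w v 0 j)%:E))%E.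
  apply: eq_integral => v _; rewrite /dotp -sumEFin.
  by apply: eq_bigr => j _; rewrite EFinM.
rewrite integral_sum//; apply: big1 => j _; rewrite integralZl//.
rewrite /noise; under eq_integral do rewrite subr_rowE.
by rewrite (integral_gradient_noise_eq0 iF dF df vF) mule0.
Qed.

End gradient_noise.

(** * Solving the recursion *)

Section recursion.
Context (R : realType).

(** If the expectation of [V] is infinite, so is the right-hand side, as [q > 0]; otherwise every
    term is integrable and the cross terms [c i] vanish in mean. *)
Lemma expectation_step (d : measure_display) (T : measurableType d)
    (P : probability T R) (m : nat) (A : {set 'I_m}) (V V' : T -> R)
    (c N : 'I_m -> T -> R) (s : 'I_m -> R) (q a b K : R) :
  0 < q -> 0 <= b ->
  measurable_fun setT V -> measurable_fun setT V' ->
  (forall w, 0 <= V w) -> (forall w, 0 <= V' w) ->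
  (forall i, i \in A -> measurable_fun setT (N i)) ->
  (forall i w, 0 <= N i w) ->
  (forall i, i \in A -> (\int[P]_w (N i w)%:E <= (s i)%:E)%E) ->
  (forall i, i \in A -> (\int[P]_w (V w)%:E < +oo)%E ->
     P.-integrable setT (EFin \o c i) /\ (\int[P]_w (c i w)%:E = 0)%E) ->
  (forall w, V' w <= q * V w + a * (\sum_(i in A) c i w) + b * (\sum_(i in A) N i w) + K) ->
  (\int[P]_w (V' w)%:E <= q%:E * \int[P]_w (V w)%:E + (b * (\sum_(i in A) s i) + K)%:E)%E.
Proof.
move=> q0 b0 mV mV' V0 V'0 mN N0 Ns hc step.
have [Voo|Vfin] := eqVneq (\int[P]_w (V w)%:E)%E +oo%E.
  by rewrite Voo gt0_muley ?lte_fin// addye// leey.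
have {}Vfin : (\int[P]_w (V w)%:E < +oo)%E by rewrite lt_neqAle Vfin leey.
have int_ge0 (u : T -> R) : measurable_fun setT u -> (forall w, 0 <= u w) ->
    (\int[P]_w (u w)%:E < +oo)%E -> P.-integrable setT (EFin \o u).
  move=> mu u0 uoo; apply/integrableP; split; first exact/measurable_EFinP.
  by under eq_integral do rewrite /= ger0_norm//.
have iV := int_ge0 _ mV V0 Vfin.
(* Extension by zero outside [A], so that integrability holds for all indices. *)
pose N' i := if i \in A then N i else cst 0.
pose c' i := if i \in A then c i else cst 0.
have iN' i : P.-integrable setT (EFin \o N' i).
  rewrite /N'; case: ifPn => [iA|_]; last exact: integrable0.
  by apply: int_ge0 => //; [exact: mN|exact: le_lt_trans (Ns _ iA) (ltry _)].
have ic' i : P.-integrable setT (EFin \o c' i).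
  rewrite /c'; case: ifPn => [iA|_]; last exact: integrable0.
  by case: (hc i iA Vfin).
have sumN w : \sum_(i in A) N i w = \sum_i N' i w.
  by rewrite big_mkcond; apply: eq_bigr => i _; rewrite /N'; case: ifP.
have sumc w : \sum_(i in A) c i w = \sum_i c' i w.
  by rewrite big_mkcond; apply: eq_bigr => i _; rewrite /c'; case: ifP.
have int_sum (u : 'I_m -> T -> R) : (forall i, P.-integrable setT (EFin \o u i)) ->
    P.-integrable setT (EFin \o (fun w => \sum_i u i w)) /\
    (\int[P]_w (\sum_i u i w)%:E = \sum_i \int[P]_w (u i w)%:E)%E.
  move=> iu; split.
    rewrite (_ : _ \o _ = (fun w => \sum_i (u i w)%:E)%E); last by apply/funext => w; rewrite /= sumEFin.
    apply: (integrable_sum measurableT) => i _; exact: iu.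
  by under eq_integral do rewrite -sumEFin; rewrite integral_sum.
have [isN eN] := int_sum _ iN'; have [isc ec] := int_sum _ ic'.
have intZ (r : R) (u : T -> R) : P.-integrable setT (EFin \o u) ->
    P.-integrable setT (EFin \o (fun w => r * u w)) /\
    (\int[P]_w (r * u w)%:E = r%:E * \int[P]_w (u w)%:E)%E.
  move=> iu; split.
    rewrite (_ : _ \o _ = (fun w => r%:E * (u w)%:E)%E); last by apply/funext => w; rewrite /= EFinM.
    exact: integrableZl.
  by under eq_integral do rewrite EFinM; rewrite integralZl.
have [iqV eqV] := intZ q _ iV; have [ibN ebN] := intZ b _ isN; have [iac eac] := intZ a _ isc.
have intD (u v : T -> R) : P.-integrable setT (EFin \o u) -> P.-integrable setT (EFin \o v) ->
    P.-integrable setT (EFin \o (fun w => u w + v w)) /\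
    (\int[P]_w (u w + v w)%:E = \int[P]_w (u w)%:E + \int[P]_w (v w)%:E)%E.
  move=> iu iv; split; last exact: integralD_EFin.
  rewrite (_ : _ \o _ = (EFin \o u) \+ (EFin \o v))%E//; exact: integrableD.
have iK : P.-integrable setT (EFin \o (fun=> K)) by exact: finite_measure_integrable_cst.
have [i1 e1] := intD _ _ iqV iac; have [i2 e2] := intD _ _ i1 ibN; have [i3 e3] := intD _ _ i2 iK.
have eK : (\int[P]_w K%:E = K%:E)%E.
  rewrite -[RHS]mule1 -(probability_setT P); exact: integral_cst.
apply: (@le_trans _ _ (\int[P]_w (q * V w + a * (\sum_i c' i w) + b * (\sum_i N' i w) + K)%:E)%E).
  apply: ge0_le_integral => //.
  - by move=> w _; rewrite lee_fin.
  - exact/measurable_EFinP.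
  - exact: measurable_int i3.
  - by move=> w _; rewrite lee_fin -sumc -sumN.
rewrite e3 e2 e1 eqV eac ebN ec eN eK big1 ?mule0 ?adde0; last first.
  move=> i _; rewrite /c'; case: ifPn => [iA|_]; last exact: integral0.
  by case: (hc i iA Vfin).
rewrite EFinD addeA leeD2r// leeD2l// EFinM lee_wpmul2l ?lee_fin//.
rewrite [in leRHS]big_mkcond/= -sumEFin; apply: lee_sum => i _.
by rewrite /N'; case: ifPn => [/Ns//|_]; rewrite integral0.
Qed.

Lemma contraction_rate (eta al D0 D2 : R) (e : nat -> R) (k0 : nat) :
  0 < eta -> 0 <= al -> eta * al <= 1 -> 0 <= e 0%N -> 0 <= D0 -> 0 <= D2 ->
  (forall k, (k < k0)%N -> e k.+1 <= (1 - eta * al) * e k + (al ^+ 2 * D0 + al * D2)) ->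
  forall k, (k < k0)%N ->
    e k.+1 <= (1 - eta * al) ^+ k * e 0%N + 1 / eta * (al * D0 + D2).
Proof.
move=> eta0 al0 ea e0 D00 D20 step.
set B := 1 / eta * _.
have B0 : 0 <= B by rewrite mulr_ge0 ?divr_ge0 ?addr_ge0 ?mulr_ge0// ltW.
(* That is, [B] is the fixed point of the affine recursion. *)
have BE : al ^+ 2 * D0 + al * D2 = eta * al * B by rewrite /B; field; rewrite gt_eqF.
have q0 : 0 <= 1 - eta * al by rewrite subr_ge0.
have q1 : 1 - eta * al <= 1 by rewrite gerBl mulr_ge0// ltW.
have main k : (k <= k0)%N -> e k <= (1 - eta * al) ^+ k * e 0%N + B.
  elim: k => [_|k IH kk0]; first by rewrite expr0 mul1r lerDl.
  apply: (le_trans (step k kk0)); rewrite BE exprS.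
  have := ler_wpM2l q0 (IH (ltnW kk0)); lra.
(* The induction yields the exponent [k + 1]; it is relaxed to [k]. *)
move=> k kk0; apply: (le_trans (main k.+1 kk0)); rewrite lerD2r ler_wpM2r// exprS.
by rewrite ler_piMl// exprn_ge0.
Qed.

(** The second lower bound on [D1] starts the induction at [k0]; the first, with [eta * abar > 1],
    carries it on. *)
Lemma sublinear_rate (eta abar D0 D1 D2 : R) (e : nat -> R) (k0 : nat) :
  0 < eta -> 1 < eta * abar -> eta * (abar / k0.+1%:R) <= 1 ->
  0 <= abar -> 0 <= D0 -> 0 <= D2 -> 0 <= e k0 ->
  abar ^+ 2 * D0 / (eta * abar - 1) <= D1 ->
  k0.+1%:R * e k0 + abar ^+ 2 * D0 / k0.+1%:R <= D1 ->
  (forall k, (k0 <= k)%N -> e k.+1 <= (1 - eta * (abar / k.+1%:R)) * e k +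
     ((abar / k.+1%:R) ^+ 2 * D0 + abar / k.+1%:R * D2)) ->
  forall k, (k0 <= k)%N -> e k.+1 <= D1 / k.+1%:R + abar * D2.
Proof.
move=> eta0 c1 q1 abar0 D00 D20 ek0 hD1 hD1' step k.
have {}hD1 : abar ^+ 2 * D0 <= (eta * abar - 1) * D1.
  by rewrite [leRHS]mulrC -ler_pdivrMr ?subr_gt0.
have D10 : 0 <= D1.
  rewrite -(pmulr_rge0 _ (_ : 0 < eta * abar - 1)) ?subr_gt0//.
  by rewrite (le_trans _ hD1)// mulr_ge0// sqr_ge0.
move=> /subnKC <-; elim: (k - k0)%N => [|j IH].
  rewrite addn0; apply: (le_trans (step k0 (leqnn _))).
  have y0 : 0 < k0.+1%:R :> R by [].
  set y := k0.+1%:R in y0 q1 hD1' *.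
  have h1 : e k0 + (abar / y) ^+ 2 * D0 <= D1 / y.
    rewrite ler_pdivlMr// (le_trans _ hD1')// le_eqVlt; apply/orP; left; apply/eqP.
    by field; rewrite gt_eqF.
  have h2 : abar / y * D2 <= abar * D2.
    by rewrite ler_wpM2r// ler_pdivrMr// ler_peMr// /y ler1n.
  have h3 : 0 <= eta * (abar / y) * e k0 by rewrite !mulr_ge0 ?invr_ge0// ltW.
  clear - h1 h2 h3; clearbody y; move: h1 h2 h3; set u := abar / y; set v := D1 / y; lra.
rewrite addnS; apply: (le_trans (step _ (leqW (leq_addr _ _)))).
have kj : k0.+1%:R <= (k0 + j).+2%:R :> R by rewrite ler_nat ltnS leqW// leq_addr.
set x : R := (k0 + j).+1%:R in IH *.
have x0 : 0 < x by rewrite /x.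
have -> : (k0 + j).+2%:R = x + 1 :> R by rewrite /x natr1.
have xq : eta * (abar / (x + 1)) <= 1.
  apply: le_trans q1; rewrite ler_pM2l// ler_wpM2l// lef_pV2 ?posrE//; last by rewrite addr_gt0.
  by rewrite /x natr1.
have x1 : 0 < x + 1 by rewrite addr_gt0.
have q0 : 0 <= 1 - eta * (abar / (x + 1)) by rewrite subr_ge0.
have H := ler_wpM2l q0 IH.
have H2 : (abar / (x + 1)) ^+ 2 * D0 <= (eta * abar - 1) * D1 / (x + 1) ^+ 2.
  rewrite ler_pdivlMr ?exprn_gt0//; apply: le_trans hD1.
  by rewrite le_eqVlt; apply/orP; left; apply/eqP; field; rewrite gt_eqF.
have H3 : 0 <= (eta * abar - 1) * (abar * D2 / (x + 1) + D1 / (x * (x + 1) ^+ 2)).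
  apply: mulr_ge0; first by rewrite subr_ge0 ltW.
  apply: addr_ge0; apply: divr_ge0 => //; [exact: mulr_ge0|exact: ltW|].
  exact: mulr_ge0 (ltW x0) (exprn_ge0 2 (ltW x1)).
(* The slack of the induction step in closed form, nonnegative by [H3]. *)
have E : D1 / (x + 1) + abar * D2 - ((1 - eta * (abar / (x + 1))) * (D1 / x + abar * D2) +
    ((eta * abar - 1) * D1 / (x + 1) ^+ 2 + abar / (x + 1) * D2)) =
    (eta * abar - 1) * (abar * D2 / (x + 1) + D1 / (x * (x + 1) ^+ 2)).
  by field; rewrite ?gt_eqF// ?(gt_eqF x1) ?(gt_eqF x0).
rewrite -subr_ge0; apply: le_trans H3 _; rewrite -E lerD2l lerN2; exact: lerD H (lerD H2 (lexx _)).
Qed.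

(** The errors are extended reals: finiteness propagates forward, so the real recursions apply once
    an error is finite, and an infinite starting error makes the bound trivial. *)
Lemma expected_rate (eta alow abar D0 D2 : R) (err : nat -> \bar R) (alpha : nat -> R) :
  0 < eta -> 0 < alow -> eta * alow < 1 -> 1 / eta < abar -> 0 <= D0 -> 0 <= D2 ->
  (forall k, alpha k.+1 = Num.min alow (abar / k.+1%:R)) ->
  (forall k, 0 <= err k)%E ->
  (forall k, (err k.+1 <= (1 - eta * alpha k.+1)%:E * err k
     + (alpha k.+1 ^+ 2 * D0 + alpha k.+1 * D2)%:E)%E) ->
  exists k0 : nat,
    let Delta1 : \bar R :=
      Order.max (abar ^+ 2 * D0 / (eta * abar - 1))%:E
        (k0.+1%:R%:E * err k0 + (abar ^+ 2 * D0 / k0.+1%:R)%:E)%E in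
    [/\ abar / k0.+1%:R <= alow,
        forall k : nat, abar / k.+1%:R <= alow -> (k0 <= k)%N,
        forall k : nat, (k < k0)%N ->
          (err k.+1 <= ((1 - eta * alow) ^+ k)%:E * err 0%N
                       + (1 / eta * (alow * D0 + D2))%:E)%E &
        forall k : nat, (k0 <= k)%N ->
          (err k.+1 <= Delta1 * (k.+1%:R^-1)%:E + (abar * D2)%:E)%E].
Proof.
move=> eta0 al0 ea1 habar D00 D20 alphaE err0 step.
have c1 : 1 < eta * abar by rewrite mulrC -ltr_pdivrMr.
have abar0 : 0 < abar by rewrite (lt_trans _ habar)// divr_gt0.
have [n hn] : exists n, abar / n.+1%:R <= alow.
  exists (Num.truncn (abar / alow)); rewrite ler_pdivrMr// mulrC -ler_pdivrMr//.
  by apply/ltW/truncnS_gt.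
have ex : exists n, abar / n.+1%:R <= alow by exists n.
pose k0 := ex_minn (P := fun n => abar / n.+1%:R <= alow) ex.
have [k0P k0min] : abar / k0.+1%:R <= alow /\ forall k, abar / k.+1%:R <= alow -> (k0 <= k)%N.
  by rewrite /k0; case: ex_minnP.
have fin_step k : (err k < +oo)%E -> (err k.+1 < +oo)%E.
  move=> koo; apply: (le_lt_trans (step k)).
  have : err k \is a fin_num by rewrite ge0_fin_numE.
  by move=> /fineK <-; rewrite -EFinM -EFinD ltry.
have fin_all k j : (err k < +oo)%E -> (err (k + j)%N < +oo)%E.
  by move=> koo; elim: j => [|j IH]; rewrite ?addn0// addnS fin_step.
pose e k := fine (err k).
have eE k : (err k < +oo)%E -> err k = (e k)%:E.
  by move=> koo; rewrite fineK// ge0_fin_numE.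
have e_ge0 k : 0 <= e k by exact: fine_ge0.
have estep k : (err k < +oo)%E ->
    e k.+1 <= (1 - eta * alpha k.+1) * e k + (alpha k.+1 ^+ 2 * D0 + alpha k.+1 * D2).
  by move=> koo; have := step k; rewrite (eE _ (fin_step k koo)) (eE _ koo) -EFinM -EFinD lee_fin.
have alpha_lt k : (k < k0)%N -> alpha k.+1 = alow.
  move=> kk0; rewrite alphaE min_l//; apply/ltW; rewrite ltNge.
  by apply/negP => /k0min; rewrite leqNgt kk0.
have alpha_ge k : (k0 <= k)%N -> alpha k.+1 = abar / k.+1%:R.
  move=> kk0; rewrite alphaE min_r//; apply: le_trans k0P.
  by rewrite ler_pM2l// lef_pV2 ?posrE// ler_nat.
exists k0; split=> //.
- move=> k kk0.
  (* An infinite [err 0] stays infinite after multiplication, since [eta * alow < 1] strictly. *)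
  have [e0oo|e0fin] := eqVneq (err 0%N) +oo%E.
    by rewrite e0oo gt0_muley ?lte_fin ?exprn_gt0 ?subr_gt0// addye// leey.
  have {}e0fin : (err 0%N < +oo)%E by rewrite lt_neqAle e0fin leey.
  have fin j : (err j < +oo)%E by have := fin_all 0%N j e0fin; rewrite add0n.
  rewrite (eE _ (fin _)) (eE _ e0fin) -EFinM -EFinD lee_fin.
  apply: (contraction_rate eta0 (ltW al0) (ltW ea1) (e_ge0 0%N) D00 D20 (k0 := k0)) => // j jk0.
  by have := estep j (fin j); rewrite alpha_lt.
- move=> k kk0; set M := Order.max _ _.
  have [ekoo|ekfin] := eqVneq (err k0) +oo%E.
    have -> : M = +oo%E.
      by rewrite /M ekoo gt0_muley ?lte_fin// addye// maxey.
    by rewrite gt0_mulye ?lte_fin ?invr_gt0// addye// leey.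
  have {}ekfin : (err k0 < +oo)%E by rewrite lt_neqAle ekfin leey.
  have fin j : (k0 <= j)%N -> (err j < +oo)%E.
    by move=> /subnKC <-; exact: fin_all.
  pose D1 := Num.max (abar ^+ 2 * D0 / (eta * abar - 1))
    (k0.+1%:R * e k0 + abar ^+ 2 * D0 / k0.+1%:R).
  have -> : M = D1%:E by rewrite /M (eE _ ekfin) -EFinM -EFinD EFin_max.
  rewrite (eE _ (fin _ (leqW kk0))) -EFinM -EFinD lee_fin.
  apply: (sublinear_rate eta0 c1 _ (ltW abar0) D00 D20 (e_ge0 k0)) => //.
  + by apply: le_trans (ltW ea1); rewrite ler_pM2l.
  + by rewrite /D1 le_max lexx.
  + by rewrite /D1 le_max lexx orbT.
  + by move=> j jk0; have := estep j (fin j jk0); rewrite alpha_ge.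
Qed.

End recursion.

(** * Convergence of the iteration in both step size regimes *)

Theorem theorem2 (R : realType) (d m r q : nat) (hd : (0 < d)%N)
    (Reg Byz : {set 'I_m}) (hpart : Byz = ~: Reg)
    (hr : #|Reg| = r) (hq : #|Byz| = q)
    (p : \bar R) (hp : (1 <= p)%E) (lam : R) (hlam : 0 < lam)
    (* losses, data distributions, regularization term *)
    (dX : measure_display) (Xi : measurableType dX)
    (F : 'rV[R]_d -> Xi -> R) (D : 'I_m -> probability Xi R)
    (f0 : 'rV[R]_d -> R)
    (hFint : forall i x, (D i).-integrable setT (fun v => (F x v)%:E))
    (hFdiff : forall v x, differentiable (F^~ v) x)
    (* (1) strong convexity *)
    (mu : 'I_m -> R) (mu0 : R)
    (hmu : forall i, 0 < mu i) (hmu0 : 0 < mu0)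
    (hsc : forall i, strongly_convex (mu i) (local_cost F (D i)))
    (hsc0 : strongly_convex mu0 f0)
    (* (2) Lipschitz continuous gradients *)
    (L : 'I_m -> R) (L0 : R)
    (hL : forall i, lipschitz_gradient (L i) (local_cost F (D i)))
    (hL0 : lipschitz_gradient L0 f0)
    (* (3) sampling and bounded variance *)
    (dO : measure_display) (Omega : measurableType dO)
    (P : probability Omega R)
    (xi : 'I_m -> nat -> Omega -> Xi)
    (hiid : forall i, iid_sampling P (D i) (xi i))
    (delta : 'I_m -> R)
    (hvar : forall i, bounded_variance F (D i) (delta i))
    (* parameters and step sizes *)
    (eps : R) (heps0 : 0 < eps) (heps : eps < 2 * mu0 * L0 / (mu0 + L0))
    (eta : R)
    (heta : eta = \big[Num.min/(2 * mu0 * L0 / (mu0 + L0) - eps)]_(i in Reg)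
                     (2 * mu i * L i / (mu i + L i)))
    (alow : R)
    (halow : alow = \big[Num.min/(1 / (2 * (mu0 + L0)))]_(i in Reg)
                       (1 / (2 * (mu i + L i))))
    (abar : R) (habar : 1 / eta < abar)
    (alpha : nat -> R)
    (halpha : forall k, alpha k.+1 = Num.min alow (abar / k.+1%:R))
    (* the minimizer and the iteration *)
    (xs : stacked R m d)
    (hxs : is_minimizer
       (regularized_cost Reg lam p (fun i => local_cost F (D i)) f0) xs)
    (z s w t : 'I_m -> nat -> Omega -> 'rV[R]_d)
    (x : nat -> Omega -> stacked R m d)
    (hx : forall o, rsa_path Reg Byz lam p F f0 alpha
       (fun i k => xi i k o) (fun j k => z j k o) (fun i k => s i k o)
       (fun i k => w i k o) (fun j k => t j k o) (fun k => x k o))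
    (Fil : nat -> set (set Omega))
    (hFil : nonanticipating P Reg Fil xi x) :
  let Delta0 : R :=
    16 * lam ^+ 2 * r%:R * d%:R + 16 * lam ^+ 2 * r%:R ^+ 2 * d%:R
    + 2 * lam ^+ 2 * q%:R ^+ 2 * d%:R + 2 * \sum_(i in Reg) delta i ^+ 2 in
  let Delta2 : R := lam ^+ 2 * q%:R ^+ 2 * d%:R / eps in
  let err (k : nat) : \bar R := ('E_P[fun o => sqdist Reg (x k o) xs])%E in
  exists k0 : nat,
    let Delta1 : \bar R :=
      Order.max (abar ^+ 2 * Delta0 / (eta * abar - 1))%:E
        (k0.+1%:R%:E * err k0 + (abar ^+ 2 * Delta0 / k0.+1%:R)%:E)%E in
    [/\ abar / k0.+1%:R <= alow,
        forall k : nat, abar / k.+1%:R <= alow -> (k0 <= k)%N,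
        forall k : nat, (k < k0)%N ->
          (err k.+1 <= ((1 - eta * alow) ^+ k)%:E * err 0%N
                       + (1 / eta * (alow * Delta0 + Delta2))%:E)%E &
        forall k : nat, (k0 <= k)%N ->
          (err k.+1 <= Delta1 * (k.+1%:R^-1)%:E + (abar * Delta2)%:E)%E].
Proof.
subst r q; move=> Delta0 Delta2 err.
have df i x' : differentiable (local_cost F (D i)) x' by exact: (hL i).1.
have kpos i : 0 < mu i + L i.
  by have := strongly_convex_le_lipschitz hd (hsc i) (hL i); have := hmu i; lra.
have k0pos : 0 < mu0 + L0.
  by have := strongly_convex_le_lipschitz hd hsc0 hL0; lra.
have Lpos i : 0 < L i.
  by have := strongly_convex_le_lipschitz hd (hsc i) (hL i); have := hmu i; lra.
have L0pos : 0 < L0 by have := strongly_convex_le_lipschitz hd hsc0 hL0; lra.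
have eta_gt0 : 0 < eta.
  rewrite heta; apply/bigmin_gtP; split; first by rewrite subr_gt0.
  by move=> i _; rewrite divr_gt0 ?mulr_gt0.
have alow_gt0 : 0 < alow.
  rewrite halow; apply/bigmin_gtP; split; first by rewrite divr_gt0 ?mulr_gt0.
  by move=> i _; rewrite divr_gt0 ?mulr_gt0.
have eta0 : eta <= 2 * mu0 * L0 / (mu0 + L0) - eps by rewrite heta; exact: bigmin_le_id.
have etai i : i \in Reg -> eta <= 2 * mu i * L i / (mu i + L i).
  by move=> iR; rewrite heta; exact: bigmin_le_cond.
have alow0 : alow <= 1 / (2 * (mu0 + L0)) by rewrite halow; exact: bigmin_le_id.
have alowi i : i \in Reg -> alow <= 1 / (2 * (mu i + L i)).
  by move=> iR; rewrite halow; exact: bigmin_le_cond.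
(* The master's entries of both minima bound the product by [mu0 * L0 / (mu0 + L0)^2]. *)
have ea1 : eta * alow < 1.
  apply: (@le_lt_trans _ _ (2 * mu0 * L0 / (mu0 + L0) * (1 / (2 * (mu0 + L0))))).
    by apply: ler_pM => //; [exact: ltW|exact: ltW|apply: (le_trans eta0); rewrite gerBl ltW].
  rewrite mulf_div mulr1 ltr_pdivrMr ?mulr_gt0// mul1r; nra.
have abar0 : 0 < abar by rewrite (lt_trans _ habar)// divr_gt0.
have p1 : 0 <= lam ^+ 2 * #|Reg|%:R * d%:R.
  exact: mulr_ge0 (mulr_ge0 (sqr_ge0 _) (ler0n _ _)) (ler0n _ _).
have p2 : 0 <= lam ^+ 2 * #|Reg|%:R ^+ 2 * d%:R.
  exact: mulr_ge0 (mulr_ge0 (sqr_ge0 _) (sqr_ge0 _)) (ler0n _ _).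
have p3 : 0 <= lam ^+ 2 * #|Byz|%:R ^+ 2 * d%:R.
  exact: mulr_ge0 (mulr_ge0 (sqr_ge0 _) (sqr_ge0 _)) (ler0n _ _).
have Delta20 : 0 <= Delta2 by exact: divr_ge0 p3 (ltW heps0).
have Delta00 : 0 <= Delta0.
  have : 0 <= \sum_(i in Reg) delta i ^+ 2 by apply: sumr_ge0 => i _; exact: sqr_ge0.
  rewrite /Delta0; lra.
have [[filS film _] myi my0 _ indep] := hFil.
have mx0 k j : measurable_fun setT (fun o => (x k o).2 0 j).
  by move=> _ A mA; rewrite setTI; apply: (film k); exact: my0.
have mxk k i j : i \in Reg -> measurable_fun setT (fun o => (x k o).1 i 0 j).
  by move=> iR _ A mA; rewrite setTI; apply: (film k); exact: myi.
have msub (u : Omega -> 'rV[R]_d) c : (forall j, measurable_fun setT (fun o => u o 0 j)) ->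
    measurable_fun setT (fun o => enorm (u o - c) ^+ 2).
  move=> mu'; apply: measurable_enorm_sqr => j.
  by under eq_fun do rewrite subr_rowE; exact: measurable_funB.
have mV k : measurable_fun setT (fun o => sqdist Reg (x k o) xs).
  apply: measurable_funD; last by apply: msub => j; exact: mx0.
  under eq_fun do rewrite big_mkcond.
  apply: measurable_sum => i; case: (boolP (i \in Reg)) => // iR.
  by apply: msub => j; exact: mxk.
have V0 k o : 0 <= sqdist Reg (x k o) xs.
  by rewrite addr_ge0 ?sqr_ge0// sumr_ge0// => i _; rewrite sqr_ge0.
have errE k : err k = (\int[P]_o (sqdist Reg (x k o) xs)%:E)%E.
  by rewrite /err unlock.
have err0 k : (0 <= err k)%E.
  by rewrite errE integral_ge0// => o _; rewrite lee_fin.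
apply: (@expected_rate R eta alow abar Delta0 Delta2 err alpha) => // k.
have al0 : 0 < alpha k.+1 by rewrite halpha lt_min alow_gt0 divr_gt0.
have alk : alpha k.+1 <= alow by rewrite halpha ge_min lexx.
have [Pxi mxi] : (forall i (A : set Xi), measurable A -> P (xi i k @^-1` A) = D i A) /\
    (forall i, measurable_fun setT (xi i k)).
  by split=> i; [move=> A mA|]; case: (hiid i) => h1 h2 _; [exact: h2|exact: h1].
pose noise i o := gradient (F ^~ (xi i k o)) ((x k o).1 i) - gradient (local_cost F (D i)) ((x k o).1 i).
rewrite !errE.
have := @expectation_step R _ _ P m Reg (fun o => sqdist Reg (x k o) xs)
  (fun o => sqdist Reg (x k.+1 o) xs)
  (fun i o => dotp ((x k o).1 i - xs.1 i) (noise i o))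
  (fun i o => enorm (noise i o) ^+ 2) (fun i => delta i ^+ 2)
  (1 - eta * alpha k.+1) (- 2 * alpha k.+1) (2 * alpha k.+1 ^+ 2)
  (alpha k.+1 ^+ 2 * (16 * lam ^+ 2 * #|Reg|%:R * d%:R + 16 * lam ^+ 2 * #|Reg|%:R ^+ 2 * d%:R
        + 2 * lam ^+ 2 * #|Byz|%:R ^+ 2 * d%:R)
       + alpha k.+1 * (lam ^+ 2 * #|Byz|%:R ^+ 2 * d%:R / eps)).
(* The additive error splits into the variances, which arise in expectation, and the deterministic
   remainder of [rsa_step_le]. *)
have -> : alpha k.+1 ^+ 2 * Delta0 + alpha k.+1 * Delta2 =
   2 * alpha k.+1 ^+ 2 * (\sum_(i in Reg) delta i ^+ 2) +
  (alpha k.+1 ^+ 2 * (16 * lam ^+ 2 * #|Reg|%:R * d%:R + 16 * lam ^+ 2 * #|Reg|%:R ^+ 2 * d%:R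
        + 2 * lam ^+ 2 * #|Byz|%:R ^+ 2 * d%:R)
       + alpha k.+1 * (lam ^+ 2 * #|Byz|%:R ^+ 2 * d%:R / eps)).
  by rewrite /Delta0 /Delta2; ring.
apply.
- rewrite subr_gt0 (le_lt_trans _ ea1)// ler_pM2l//.
- by rewrite mulr_ge0 ?sqr_ge0.
- exact: mV.
- exact: mV.
- by [].
- by [].
- move=> i iR; apply: measurable_enorm_sqr => j.
  apply: (measurable_gradient_noise (filS k) (film k) (mxi i) (D := D i)
    (y := fun o => (x k o).1 i)) => //.
  exact: myi.
- by move=> i o; rewrite sqr_ge0.
- move=> i iR.
  apply: (integral_gradient_noise_sqr_le (filS k) (film k) (mxi i) (Pxi i) (indep k i iR)) => //.
  exact: myi.
- move=> i iR Voo.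
  apply: (integral_gradient_noise_cross (filS k) (film k) (mxi i) (Pxi i) (indep k i iR)
    (delta := delta i)) => //.
    exact: myi.
  (* The squared error of worker [i] is one summand of [sqdist], so its mean is finite too. *)
  apply: le_lt_trans Voo; apply: ge0_le_integral => //.
  + by move=> o _; rewrite lee_fin sqr_ge0.
  + by apply/measurable_EFinP; apply: msub => j; exact: mxk.
  + by apply/measurable_EFinP; exact: mV.
  + move=> o _; rewrite lee_fin /sqdist (bigD1 i)//= -addrA lerDl addr_ge0 ?sqr_ge0//.
    by rewrite sumr_ge0// => j _; rewrite sqr_ge0.
- move=> o; have [hs ht hxi hx0] := hx o.
  apply: (rsa_step_le (f0 := f0) (mu := mu) (L := L) (mu0 := mu0) (L0 := L0)
    (s := fun i => s i k o) (w := fun i => w i k o) (t := fun i => t i k o)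
    (z := fun i => z i k o) hd hp hlam) => //.
  + exact: ltW.
  + exact: le_trans alow0.
  + by move=> i iR; apply: (le_trans alk); exact: alowi.
  + by move=> i iR; case: (hs k i iR).
  + by move=> j jB; exact: ht.
  + by move=> i iR; exact: hxi.
Qed.
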